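(* Let $\Omega\subset\mathbb{R}^n$ be an open convex set with finite inradius $\delta_0=\delta_0(\Omega)$. Let $g\in C_0^1(\Omega)$ with $|\nabla g|\in L^2(\Omega)$. (i) If $m>1$, $\nu\in[0,1/m]$ and $\lambda\in\left[0,\frac{1+\nu m}{2}\right)$, then $$\frac{1-\nu^2m^2}{4}\int_\Omega\frac{|g(x)|^2}{\delta(x)^2}\,dx+\frac{c_\nu^2(m)+(m-1)(\lambda-\lambda^2)}{\delta_0^m}\int_\Omega\frac{|g(x)|^2}{\delta(x)^{2-m}}\,dx\le 4\left(\frac{1+\nu m}{2}-\lambda^2\right)\int_\Omega|\nabla g(x)|^2\,dx.$$ (ii) If $m>0$, $\nu\in[0,1/m)$ and $\lambda\le 0$, then $$\frac{1-\nu^2m^2}{4}\int_\Omega\frac{|g(x)|^2}{\delta(x)^2}\,dx+\frac{c_\nu^2(m)}{\delta_0^m}\int_\Omega\frac{|g(x)|^2}{\delta(x)^{2-m}}\,dx\le \left(2(1+\nu m)+|\lambda|\right)\int_\Omega|\nabla g(x)|^2\,dx.$$ Here $c_\nu(m)$ (which depends on $\lambda$) is the number satisfying $$(1-2\lambda)J_\nu\left(\tfrac{2}{m}c_\nu(m)\right)+2c_\nu(m)J_\nu'\left(\tfrac{2}{m}c_\nu(m)\right)=0\quad\text{and}\quad \tfrac{2}{m}c_\nu(m)\in(0,j_\nu).$$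
   Context: $J_\nu$ is the Bessel function of the first kind of order $\nu$, $J_\nu'$ its derivative, and $j_\nu$ the first positive zero of $J_\nu$; $c_\nu(m)$ is taken to be the first such root. For an open set $\Omega$, $\delta(x)=\operatorname{dist}(x,\partial\Omega)$ and the inradius is $\delta_0(\Omega)=\sup_{x\in\Omega}\delta(x)$. $C_0^1(\Omega)$ is the family of continuously differentiable functions $\Omega\to\mathbb{R}$ with compact support in $\Omega$. *)

(* Defs.v *)
From HB Require Import structures.
From mathcomp Require Import all_boot all_order all_algebra.
From mathcomp Require Import all_classical all_reals all_analysis.

Set Implicit Arguments.
Unset Strict Implicit.
Unset Printing Implicit Defensive.

Import Order.TTheory GRing.Theory Num.Theory.
Import numFieldNormedType.Exports.

Local Open Scope classical_set_scope.
Local Open Scope ring_scope.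

Fact measure_rV_display : measure_display.
Proof. exact: default_measure_display. Qed.

Lemma g_sigma_preimage_sub d (rT : semiRingOfSetsType d) (aT : Type) (n : nat)
    (f : 'I_n -> aT -> rT) (i : 'I_n) (A : set rT) :
  measurable A -> g_sigma_preimage f (f i @^-1` A).
Proof.
case: n f i => [f []//|n f i] mA; apply: sub_sigma_algebra.
rewrite -bigcup_mkord_ord; exists i; first exact: ltn_ord.
by exists A => //; rewrite inord_val setTI.
Qed.

Section measurable_rV.
Context {R : realType} (n : nat).

Let coor : 'I_n -> 'rV[R]_n -> measurableTypeR R := fun i x => x ord0 i.

Let rV_set0 : g_sigma_preimage coor set0.
Proof. exact: sigma_algebra0. Qed.

Let rV_setC A : g_sigma_preimage coor A -> g_sigma_preimage coor (~` A).
Proof. exact: sigma_algebraC. Qed.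

Let rV_bigcup (F : _^nat) : (forall i, g_sigma_preimage coor (F i)) ->
  g_sigma_preimage coor (\bigcup_i (F i)).
Proof. exact: sigma_algebra_bigcup. Qed.

(* The sigma-algebra of R^n generated by the coordinates (the Borel one). *)
HB.instance Definition _ := @isMeasurable.Build measure_rV_display
  'rV[R]_n (g_sigma_preimage coor) rV_set0 rV_setC rV_bigcup.

Lemma measurable_rV_comp d (T : measurableType d) (f : T -> 'rV[R]_n) :
  (forall i, measurable_fun [set: T]
     (fun t => f t ord0 i : measurableTypeR R)) ->
  measurable_fun [set: T] f.
Proof.
move=> mf.
suff H : g_sigma_preimage (fun i => coor i \o f) `<=` measurable.
  move=> _ A mA; rewrite setTI; apply: H.
  by rewrite g_sigma_preimage_comp; exists A => //; rewrite setTI.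
apply: smallest_sub; first exact: sigma_algebra_measurable.
case: n f mf @coor => [|k] f mf c; first by rewrite big_ord0.
rewrite -bigcup_mkord_ord; apply: bigcup_sub => i Ii.
by move=> _ [B mB <-]; exact: mf.
Qed.

Lemma measurable_coor i :
  measurable_fun [set: 'rV[R]_n] (fun x => x ord0 i : measurableTypeR R).
Proof. by move=> _ A mA; rewrite setTI; exact: (@g_sigma_preimage_sub _ _ _ _ coor i A mA). Qed.

End measurable_rV.

Definition cons_rV (R : realType) (n : nat)
    (p : 'rV[R]_n * measurableTypeR R) : 'rV[R]_n.+1 :=
  \row_i (if unlift ord0 i is Some j then p.1 ord0 j else p.2).

Lemma measurable_cons_rV (R : realType) (n : nat) :
  measurable_fun setT (@cons_rV R n).
Proof.
apply: measurable_rV_comp => i.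
rewrite (_ : (fun t => _) = if unlift ord0 i is Some j
  then (fun p : 'rV[R]_n * measurableTypeR R => p.1 ord0 j : measurableTypeR R)
  else snd); last first.
  by apply/funext => p; rewrite mxE; case: unlift.
case: unlift => [j|]; last exact: measurable_snd.
by apply: (measurableT_comp (measurable_coor j)); exact: measurable_fst.
Qed.

Section lebesgue_rV_step.
Context {R : realType} (n : nat).
Variable mu : {measure set 'rV[R]_n -> \bar R}.
Local Open Scope ereal_scope.

Definition cons_measure : set 'rV[R]_n.+1 -> \bar R :=
  pushforward (mu \x @lebesgue_measure R) (@cons_rV R n).

Let cons_measure0 : cons_measure set0 = 0.
Proof. by rewrite /cons_measure /pushforward preimage_set0 measure0. Qed.

Let cons_measure_ge0 A : 0 <= cons_measure A.
Proof. by rewrite /cons_measure /pushforward; exact: measure_ge0. Qed.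

Let cons_measure_sigma_additive : semi_sigma_additive cons_measure.
Proof.
move=> F mF tF mUF; rewrite /cons_measure /pushforward preimage_bigcup.
apply: measure_semi_sigma_additive.
- by move=> k; rewrite -[X in measurable X]setTI; exact: measurable_cons_rV.
- apply/trivIsetP => /= i j _ _ ij; rewrite -preimage_setI.
  by move/trivIsetP : tF => /(_ _ _ _ _ ij) ->//; rewrite preimage_set0.
- rewrite -preimage_bigcup -[X in measurable X]setTI.
  exact: measurable_cons_rV.
Qed.

HB.instance Definition _ := isMeasure.Build _ _ _ cons_measure
  cons_measure0 cons_measure_ge0 cons_measure_sigma_additive.

End lebesgue_rV_step.

Fixpoint lebesgue_rV (R : realType) (n : nat) :
    {measure set 'rV[R]_n -> \bar R} :=
  match n with
  | 0 => dirac (0 : 'rV[R]_0)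
  | k.+1 => cons_measure (lebesgue_rV R k)
  end.

Lemma lebesgue_rV_box (R : realType) (n : nat) (a b : 'rV[R]_n) :
  (forall i, a ord0 i <= b ord0 i) ->
  lebesgue_rV R n [set x | forall i, x ord0 i \in `[a ord0 i, b ord0 i]] =
  (\prod_i (b ord0 i - a ord0 i))%:E.
Proof.
elim: n a b => [|n IH] a b ab.
  by rewrite big_ord0 /= diracE mem_set//= => -[].
rewrite /= /cons_measure /pushforward.
pose a' : 'rV[R]_n := \row_i a ord0 (lift ord0 i).
pose b' : 'rV[R]_n := \row_i b ord0 (lift ord0 i).
pose B : set 'rV[R]_n := [set x | forall i, x ord0 i \in `[a' ord0 i, b' ord0 i]].
pose I : set (measurableTypeR R) := [set` `[a ord0 ord0, b ord0 ord0]].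
rewrite [X in (_ \x _)%E X](_ : _ = B `*` I); last first.
  apply/seteqP; split => -[x t] /=.
    move=> H; split.
      by move=> i; have := H (lift ord0 i); rewrite !mxE liftK.
    by have := H ord0; rewrite /= !mxE unlift_none.
  move=> [H1 H2] i; rewrite mxE; case: unliftP => [j|] -> //=.
  by have := H1 j; rewrite !mxE.
rewrite product_measure1E//; last first.
- exact: measurable_itv.
- rewrite (_ : B = \bigcap_(i in [set: 'I_n]) ((fun x : 'rV[R]_n =>
    x ord0 i : measurableTypeR R) @^-1` [set` `[a' ord0 i, b' ord0 i]])).
    apply: fin_bigcap_measurable => // i _.
    by rewrite -[X in measurable X]setTI; apply: measurable_coor => //;
      exact: measurable_itv.
  by apply/seteqP; split => x H i; [move=> _; exact: H|exact: (H i)].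
rewrite IH; last by move=> i; rewrite !mxE.
rewrite big_ord_recl /= /I.
rewrite lebesgue_measure_itv/= lte_fin.
under eq_bigr do rewrite !mxE.
case: ltP => [_|ba]; first by rewrite -EFinB -EFinM mulrC.
have -> : a ord0 ord0 = b ord0 ord0 by apply/le_anti; rewrite ab ba.
by rewrite subrr mul0r mule0.
Qed.

(* Euclidean norm; the norm `|x| on row vectors is the sup norm. *)
Definition enorm (R : realType) (n : nat) (x : 'rV[R]_n) : R :=
  Num.sqrt (\sum_i x ord0 i ^+ 2).

Definition boundary (T : topologicalType) (A : set T) : set T :=
  closure A `\` interior A.

(* Extended-real valued, so that the distance to an empty set is +oo. *)
Definition dist_boundary (R : realType) (n : nat) (Omega : set 'rV[R]_n)
    (x : 'rV[R]_n) : \bar R :=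
  ereal_inf [set (enorm (x - y))%:E | y in boundary Omega].

Definition inradius (R : realType) (n : nat) (Omega : set 'rV[R]_n) : \bar R :=
  ereal_sup [set dist_boundary Omega x | x in Omega].

Definition gradient (R : realType) (n : nat) (g : 'rV[R]_n -> R)
    (x : 'rV[R]_n) : 'rV[R]_n :=
  \row_i 'D_(delta_mx ord0 i) g x.

(* A function on Omega is represented by a total function of which only the
   values on Omega matter. *)
Definition C1_compact_support (R : realType) (n : nat) (Omega : set 'rV[R]_n)
    (g : 'rV[R]_n -> R) : Prop :=
  let supp := closure [set x | Omega x /\ g x != 0] in
  [/\ forall x, Omega x -> differentiable g x,
      forall x, Omega x -> {for x, continuous (gradient g)},
      compact supp & supp `<=` Omega].

Definition square_integrable (R : realType) (n : nat) (Omega : set 'rV[R]_n)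
    (f : 'rV[R]_n -> R) : Prop :=
  measurable_fun Omega f /\
  (\int[lebesgue_rV R n]_(x in Omega) (f x ^+ 2)%:E < +oo)%E.

Definition Gamma (R : realType) (s : R) : R :=
  \int[@lebesgue_measure R]_(t in `]0, +oo[) (t `^ (s - 1) * expR (- t)).

(* Meaningful for 0 <= nu and 0 < x. *)
Definition besselJ (R : realType) (nu x : R) : R :=
  limn (series (fun k : nat => (-1) ^+ k / (k`!%:R * Gamma (k%:R + nu + 1)) *
                               (x / 2) `^ (2 * k%:R + nu))).

Definition is_least (R : realType) (A : set R) (x : R) : Prop :=
  A x /\ lbound A x.

Definition first_besselJ_zero (R : realType) (nu j : R) : Prop :=
  is_least [set x | 0 < x /\ besselJ nu x = 0] j.

(* [c] is the number c_nu(m) attached to [lambda]: the first c for which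
   2 c / m lies in (0, j_nu) and solves the Lamb-type equation. *)
Definition bessel_root (R : realType) (nu m lambda c : R) : Prop :=
  exists2 j, first_besselJ_zero nu j &
  is_least [set c |
    [/\ (1 - 2 * lambda) * besselJ nu (2 / m * c) +
          2 * c * derive1 (besselJ nu) (2 / m * c) = 0,
        0 < 2 / m * c & 2 / m * c < j]] c.

(* Main.v *)
Require Import Defs.
From HB Require Import structures.
From mathcomp Require Import all_boot all_order all_algebra.
From mathcomp Require Import all_classical all_reals all_analysis.
From mathcomp Require Import measurable_realfun ring lra.
Set Implicit Arguments.
Unset Strict Implicit.
Unset Printing Implicit Defensive.
Import Order.TTheory GRing.Theory Num.Theory.
Import numFieldNormedType.Exports.
Local Open Scope classical_set_scope.
Local Open Scope ring_scope.

(** The inequalities follow from a supersolution of the distance. Let [f] be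
    positive, nondecreasing and concave on [(0, D)], with [D] larger than the
    inradius, and put [psi x := f (delta x)]. At each point [x] of the convex set
    [Omega] the distance [delta] lies below the linear function
    [z |-> delta x + nu . (z - x)], where [nu] is the unit vector pointing to
    [x] from a nearest boundary point ([dist_boundary_barrier]). The
    second differences of [psi] at [x] in the coordinate directions are
    therefore controlled by those of [f] along this linear function, with total
    weight [nu . nu = 1]: in the sense of second differences,
    [- Laplacian psi >= - f'' (delta)], at every point and without any
    differentiability of [delta].

    The ground-state identity ([discrete_ground_state]), applied to the
    differences [g (x + s e_i) - g x] and integrated by means of the translation
    invariance of Lebesgue measure, bounds the integral of
    [g ^ 2 * (- second difference of psi) / psi] by the integral of the squared
    difference of [g] ([discrete_hardy]). Dividing by [s ^ 2] and letting [s] tend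
    to [0] gives
    [int g ^ 2 * (- f'' / f) (delta) <= int |grad g| ^ 2]
    ([hardy_of_supersolution]).

    For [f] one takes [t ^ a * exp (- b * beta * t ^ m / m)], whose potential
    [- f'' / f] is at least
    [(a - a ^ 2) / t ^ 2 + ((m - 1 + 2 * a) * b - b ^ 2) * beta * t ^ (m - 2)]
    ([ssol_potential_ge]). No Bessel function enters [f]: the
    constants in the theorem leave enough room for an upper bound on [c] to
    suffice. With [p := (1 + nu * m) / 2] and [X := c ^ 2 / (m * (1 + nu))], the
    defining equation of [c] and the first two terms of the expansion of
    [J_(nu + 1) / J_nu] give [X + X ^ 2 / (m * (nu + 2)) <= p - lambda]
    ([bessel_root_bound]). Elementary inequalities then provide the exponents
    [a] and [b] ([exponents_lambda_ge0], [exponents_lambda_le0]), and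
    [hardy_distance] concludes. *)

(** * Derivatives of real functions *)

Section real_derivatives.
Context {R : realType}.
Implicit Types (f g : R -> R) (x a b c : R).

Lemma is_derive1D f g x a b : is_derive x 1 f a -> is_derive x 1 g b ->
  is_derive x 1 (fun t => f t + g t) (a + b).
Proof. by move=> fa gb; exact: is_deriveD. Qed.

Lemma is_derive1B f g x a b : is_derive x 1 f a -> is_derive x 1 g b ->
  is_derive x 1 (fun t => f t - g t) (a - b).
Proof. by move=> fa gb; exact: is_deriveB. Qed.

Lemma is_derive1M f g x a b : is_derive x 1 f a -> is_derive x 1 g b ->
  is_derive x 1 (fun t => f t * g t) (a * g x + f x * b).
Proof.
move=> fa gb; apply: is_derive_eq (is_deriveM fa gb) _.
by rewrite /GRing.scale/= addrC mulrC.
Qed.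

Lemma is_derive1Z c f x a : is_derive x 1 f a ->
  is_derive x 1 (fun t => c * f t) (c * a).
Proof.
move=> fa; apply: is_derive_eq (is_derive1M (is_derive_cst c x 1) fa) _.
by rewrite mul0r add0r.
Qed.

Lemma is_derive1_continuous f x a : is_derive x 1 f a -> {for x, continuous f}.
Proof.
by move=> [fd _]; apply/differentiable_continuous/derivable1_diffP.
Qed.

End real_derivatives.

(** * The Gamma function *)

(** From [ln u <= u - 1] at [u = t / (2 * r)]. *)
Lemma powR_le_expR_half (R : realType) (r t : R) : 0 <= r -> 0 <= t ->
  t `^ r <= (2 * r) `^ r * expR (t / 2).
Proof.
rewrite le_eqVlt => /predU1P[<- t0|r0].
  by rewrite !powRr0 mul1r -(@expR0 R) ler_expR divr_ge0.
rewrite le_eqVlt => /predU1P[<-|t0].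
  by rewrite powR0 ?gt_eqF// mulr_ge0 ?powR_ge0 ?expR_ge0.
have r20 : 0 < 2 * r by rewrite mulr_gt0.
have -> : t `^ r = (2 * r) `^ r * (t / (2 * r)) `^ r.
  rewrite -powRM ?divr_ge0 ?(ltW t0) ?(ltW r20)//; congr (_ `^ _); field.
  by rewrite gt_eqF.
rewrite ler_wpM2l ?powR_ge0//.
have q0 : 0 < t / (2 * r) by rewrite divr_gt0.
rewrite /powR gt_eqF// ler_expR.
have := @le_ln1Dx _ (t / (2 * r) - 1).
rewrite addrCA subrr addr0 => h.
have {}h : ln (t / (2 * r)) <= t / (2 * r) by rewrite (le_trans (h _))//; lra.
apply: le_trans (ler_wpM2l (ltW r0) h) _.
by rewrite le_eqVlt; apply/orP; left; apply/eqP; field; rewrite gt_eqF.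
Qed.

Lemma powR_cvg_at0 (R : realType) (r : R) : 0 <= r ->
  t `^ r @[t --> 0^'+] --> (0:R) `^ r.
Proof.
rewrite le_eqVlt => /predU1P[<-|r0].
  under eq_fun do rewrite powRr0.
  by rewrite powRr0; exact: cvg_cst.
by rewrite powR0 ?gt_eqF//; exact: powR_cvg0.
Qed.

Lemma continuous_powR_gt0 (R : realType) (r t : R) : 0 < t ->
  {for t, continuous (fun x : R => x `^ r)}.
Proof.
move=> t0; apply/differentiable_continuous/derivable1_diffP.
by have := is_derive1_powR r t0; case.
Qed.

Section gamma.
Context {R : realType}.
Let mu := @lebesgue_measure R.

Let gam (r t : R) := t `^ r * expR (- t).

Let gam_cont (r : R) : 0 <= r -> {within `[0, +oo[, continuous (gam r)}.
Proof.
move=> r0; apply/continuous_within_itvcyP; split.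
  move=> x; rewrite in_itv/= andbT => x0.
  apply: cvgM; first exact: (continuous_powR_gt0 x0).
  by apply: continuous_comp; [exact: opp_continuous|exact: continuous_expR].
apply: cvgM; first exact: powR_cvg_at0.
apply: cvg_at_right_filter.
by apply: continuous_comp; [exact: opp_continuous|exact: continuous_expR].
Qed.

Let gam_meas (r : R) : measurable_fun setT (fun t => (gam r t)%:E).
Proof.
apply/measurable_EFinP; apply: measurable_funM; first exact: measurable_powR.
by apply: measurableT_comp => //; exact: measurable_expR.
Qed.

(* [C r * E t] is an integrable majorant of [t ^ r * exp (- t)] *)
Let C (r : R) := (2 * r) `^ r.
Let E (t : R) := expR (- (t / 2)).

Let gamE (r t : R) : 0 <= r -> 0 <= t -> gam r t <= C r * E t.
Proof.
move=> r0 t0; rewrite /gam /C /E (_ : - t = - (t / 2) - t / 2); last by field.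
rewrite [expR (_ - _)]expRD mulrA ler_wpM2r ?expR_ge0//.
rewrite -ler_pdivlMr ?expR_gt0// -expRN opprK.
exact: powR_le_expR_half.
Qed.

Let E_cont : continuous E.
Proof.
move=> x; apply: continuous_comp; last exact: continuous_expR.
by apply: continuousN; apply: continuousM => //; exact: cst_continuous.
Qed.

Let E_cvg : E t @[t --> +oo%R] --> 0.
Proof.
apply: (@cvg_comp _ _ _ (fun t : R => t / 2) (fun t : R => expR (- t)) _ +oo%R);
  last exact: cvgr_expR.
by apply: gt0_cvgMly => //; exact: cvg_id.
Qed.

Let E_der (t : R) : is_derive t 1 E (- (1 / 2) * E t).
Proof.
rewrite mulrC; apply: is_derive1_comp.
rewrite (_ : (fun t : R => _) = fun t : R => - (1 / 2) * t); last first.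
  by apply/funext => u; field.
rewrite -[X in is_derive _ _ _ X]mulr1; apply: is_derive1Z.
Qed.

Let intE : (\int[mu]_(t in `[0%R, +oo[) (E t)%:E = 2%:E)%E.
Proof.
rewrite (@ge0_continuous_FTC2y _ _ (fun t => - 2 * E t) 0 0).
- by rewrite /E mul0r oppr0 expR0 mulr1 -EFinB; congr EFin; ring.
- by move=> x _; exact: expR_ge0.
- by apply: continuous_subspaceT; exact: E_cont.
- by rewrite -[X in _ --> X](mulr0 (- 2)); apply: cvgM; [exact: cvg_cst|exact: E_cvg].
- by move=> x _; have [] := is_derive1Z (- 2) (E_der x).
- apply: cvgM; first exact: cvg_cst.
  by apply: cvg_at_right_filter; exact: E_cont.
- move=> x _; rewrite derive1E.
  by have [_ ->] := is_derive1Z (- 2) (E_der x); field.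
Qed.

Let igam r := (\int[mu]_(t in `[0%R, +oo[) (gam r t)%:E)%E.

Let gam_ge0 (r t : R) : 0 <= gam r t.
Proof. by rewrite mulr_ge0 ?powR_ge0 ?expR_ge0. Qed.

Let E_meas : measurable_fun setT (fun t => (E t)%:E).
Proof.
apply/measurable_EFinP; apply: measurableT_comp; first exact: measurable_expR.
by apply: measurableT_comp => //; exact: measurable_funM.
Qed.

Let CE_meas (k : R) : measurable_fun setT (fun t => (k * E t)%:E).
Proof.
apply/measurable_EFinP; apply: measurable_funM => //.
by apply/measurable_EFinP; exact: E_meas.
Qed.

Let intCE (k : R) : 0 <= k -> (\int[mu]_(t in `[0%R, +oo[) (k * E t)%:E = (2 * k)%:E)%E.
Proof.
move=> k0; under eq_integral do rewrite EFinM.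
rewrite ge0_integralZl_EFin//; first by rewrite intE -EFinM mulrC.
  by move=> x _; rewrite lee_fin expR_ge0.
by apply: measurable_funTS.
Qed.

Let igam_fin (r : R) : 0 <= r -> igam r \is a fin_num.
Proof.
move=> r0; rewrite ge0_fin_numE; last first.
  by apply: integral_ge0 => x _; rewrite lee_fin gam_ge0.
apply: (@le_lt_trans _ _ (2 * C r)%:E); last by rewrite ltry.
rewrite -intCE; last exact: powR_ge0.
apply: ge0_le_integral => //=.
- by move=> x _; rewrite lee_fin gam_ge0.
- exact: measurable_funTS (gam_meas _).
- exact: measurable_funTS (CE_meas _).
- by move=> x; rewrite in_itv/= andbT => x0; rewrite lee_fin gamE.
Qed.

Let GammaE s : Gamma s = fine (igam (s - 1)).
Proof.
rewrite /Gamma /Rintegral integral_itv_obnd_cbnd//.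
exact: measurable_funTS (gam_meas _).
Qed.

(** Integration by parts is read off the fundamental theorem of calculus for
    [t ^ s * exp (- t)]; a multiple of [exp (- t / 2)] is added so that the
    integrand is nonnegative on the whole half-line. *)
Lemma GammaS (s : R) : 1 <= s -> Gamma (s + 1) = s * Gamma s :> R.
Proof.
move=> s1; have s0 : 0 <= s - 1 by rewrite subr_ge0.
have s0' : 0 < s by apply: lt_le_trans s1.
rewrite !GammaE addrK.
pose h (t : R) := s * gam (s - 1) t - gam s t + C s * E t.
have h_ge0 (t : R) : 0 <= t -> 0 <= h t.
  move=> t0; rewrite /h -addrA addr_ge0//.
    by apply: mulr_ge0; [exact: ltW|exact: gam_ge0].
  by rewrite addrC subr_ge0 gamE// ltW.
have gam_der (t : R) : 0 < t -> is_derive t 1 (gam s) (s * gam (s - 1) t - gam s t).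
  move=> t0; rewrite /gam.
  have h2 : is_derive t (1:R) (fun t : R => expR (- t)) (expR (- t) * -1).
    by apply: is_derive1_comp; apply: is_derive_eq.
  apply: is_derive_eq (is_derive1M (is_derive1_powR s t0) h2) _.
  by ring.
have ih : (\int[mu]_(t in `[0%R, +oo[) (h t)%:E = (2 * C s)%:E)%E.
  rewrite (@ge0_continuous_FTC2y _ _ (fun t => gam s t - 2 * C s * E t) 0 0).
  - by rewrite /gam powR0 ?gt_eqF// /E !mul0r oppr0 expR0 -EFinB; congr EFin; ring.
  - exact: h_ge0.
  - rewrite /h.
    have c1 := gam_cont s0; have c2 := gam_cont (ltW s0').
    have c3 : {within `[0, +oo[, continuous E} by exact: continuous_subspaceT.
    move=> x; apply: cvgD.
      apply: cvgB; last exact: c2.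
      by apply: cvgM; [exact: cvg_cst|exact: c1].
    by apply: cvgM; [exact: cvg_cst|exact: c3].
  - rewrite -[X in _ --> X](subr0 (0:R)) -[X in _ - X](mulr0 (2 * C s)).
    apply: cvgB; last by apply: cvgM; [exact: cvg_cst|exact: E_cvg].
    apply: (@squeeze_cvgr _ _ _ _ (cst 0) (fun t => C s * E t)).
    + exists 0; split; first exact: real0.
      by move=> t t0; rewrite gam_ge0/= gamE ?ltW.
    + exact: cvg_cst.
    + by rewrite -[X in _ --> X](mulr0 (C s)); apply: cvgM; [exact: cvg_cst|exact: E_cvg].
  - by move=> x x0; have [] := is_derive1B (gam_der _ x0) (is_derive1Z (2 * C s) (E_der x)).
  - have /continuous_within_itvcyP[_ c2] := gam_cont (ltW s0').
    apply: cvgB; first exact: c2.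
    apply: cvgM; first exact: cvg_cst.
    by apply: cvg_at_right_filter; exact: E_cont.
  - move=> x; rewrite in_itv/= andbT => x0; rewrite derive1E.
    have h1 := gam_der _ x0; have h2 := E_der x.
    have [_ ->] := is_derive1B h1 (is_derive1Z (2 * C s) h2).
    by rewrite /h; field.
have mh : measurable_fun setT (fun t => (h t)%:E).
  apply/measurable_EFinP; apply: measurable_funD.
    apply: measurable_funB.
      by apply: measurable_funM => //; apply/measurable_EFinP; exact: gam_meas.
    by apply/measurable_EFinP; exact: gam_meas.
  by apply: measurable_funM => //; apply/measurable_EFinP; exact: E_meas.
have key : (\int[mu]_(t in `[0%R, +oo[) ((h t)%:E + (gam s t)%:E) =
   \int[mu]_(t in `[0%R, +oo[) (s%:E * (gam (s - 1) t)%:E + (C s * E t)%:E))%E.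
  by apply: eq_integral => x _; rewrite -EFinM -!EFinD /h; congr EFin; ring.
move: key; rewrite ge0_integralD//; last 4 first.
- by move=> x; rewrite /= in_itv/= andbT => x0; rewrite lee_fin h_ge0.
- exact: measurable_funTS mh.
- by move=> x _; rewrite lee_fin gam_ge0.
- exact: measurable_funTS (gam_meas _).
rewrite ge0_integralD//; last 4 first.
- move=> x _; apply: mule_ge0; first by rewrite lee_fin ltW.
  by rewrite lee_fin gam_ge0.
- apply: measurable_funTS; apply: measurable_funeM; exact: gam_meas.
- by move=> x _; rewrite lee_fin mulr_ge0 ?powR_ge0 ?expR_ge0.
- exact: measurable_funTS (CE_meas _).
rewrite ge0_integralZl_EFin ?(ltW s0')//; last 2 first.
- by move=> x _; rewrite lee_fin gam_ge0.
- exact: measurable_funTS (gam_meas _).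
rewrite ih intCE ?powR_ge0// -/(igam s) -/(igam (s - 1)).
rewrite -(fineK (igam_fin (ltW s0'))) -(fineK (igam_fin s0)) -EFinM -!EFinD.
by move=> H; have {H} := EFin_inj H; move=> H; apply: (@addrI _ (2 * C s)); rewrite /= H addrC.
Qed.

Lemma Gamma_gt0 (s : R) : 1 <= s -> 0 < Gamma s :> R.
Proof.
move=> s1; have s0 : 0 <= s - 1 by rewrite subr_ge0.
rewrite GammaE; apply: (@lt_le_trans _ _ (expR (- 2))); first exact: expR_gt0.
(* on [1, 2] the integrand is at least [exp (- 2)] *)
rewrite -lee_fin fineK ?igam_fin//.
apply: (@le_trans _ _ (\int[mu]_(t in `[1%R, 2%R]) (gam (s - 1) t)%:E)%E).
  rewrite [leLHS](_ : _ = \int[mu]_(t in `[1%R, 2%R]) (cst (expR (-2))%:E t))%E.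
    apply: ge0_le_integral => //=.
    - exact: measurable_funTS (gam_meas _).
    - move=> x; rewrite in_itv/= => /andP[x1 x2].
      rewrite lee_fin /gam -[leLHS]mul1r ler_pM ?expR_ge0//; last first.
        by rewrite ler_expR; lra.
      have : 1 `^ (s - 1) <= x `^ (s - 1) by rewrite ge0_ler_powR ?nnegrE//; lra.
      by rewrite powR1.
  rewrite integral_cst//= lebesgue_measure_itv/= lte_fin.
  have -> : (1 < 2 :> R) by lra.
  by rewrite -EFinB -EFinM; congr EFin; ring.
apply: ge0_subset_integral => //=.
- exact: measurable_funTS (gam_meas _).
- by move=> x _; rewrite lee_fin gam_ge0.
- by move=> x /=; rewrite !in_itv/= andbT => /andP[x1 _]; lra.
Qed.

End gamma.

(** * Bessel functions and the bound on the root *)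

Definition clifford_coef (R : realType) (nu : R) (k : nat) : R :=
  (-1) ^+ k / (k`!%:R * Gamma (k%:R + nu + 1)).

(** The Bessel-Clifford function: the entire factor of the Bessel function,
    [J_nu x = (x / 2) ^ nu * clifford nu ((x / 2) ^ 2)]. *)
Definition clifford (R : realType) (nu w : R) : R :=
  limn (pseries (clifford_coef nu) w).

Section clifford_theory.
Context {R : realType}.
Implicit Types nu w : R.

(** A crude bound, which suffices to compare [clifford] with the exponential
    series. *)
Lemma Gamma_le_shift nu (k : nat) : 0 <= nu ->
  Gamma (nu + 1) <= Gamma (k%:R + nu + 1).
Proof.
move=> nu0; elim: k => [|k IH]; first by rewrite add0r.
have k1 : 1 <= k%:R + nu + 1 by rewrite lerDr addr_ge0.
rewrite -natr1 (_ : _ + nu + 1 = (k%:R + nu + 1) + 1); last by ring.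
rewrite [leRHS]GammaS//; apply: (le_trans IH).
by rewrite ler_peMl// ltW// Gamma_gt0.
Qed.

Lemma clifford_coefS nu k : 0 <= nu ->
  clifford_coef nu k = (k%:R + nu + 1) * clifford_coef (nu + 1) k.
Proof.
move=> nu0; rewrite /clifford_coef.
have k1 : 1 <= k%:R + nu + 1 by rewrite lerDr addr_ge0.
rewrite (_ : k%:R + (nu + 1) + 1 = (k%:R + nu + 1) + 1); last by ring.
rewrite (GammaS k1); field.
rewrite !gt_eqF ?Gamma_gt0 ?ltr0n ?fact_gt0//.
by rewrite (lt_le_trans ltr01).
Qed.

Lemma pseries_diffs_clifford nu :
  pseries_diffs (clifford_coef nu) = - clifford_coef (nu + 1).
Proof.
apply/funext => k; rewrite /pseries_diffs /clifford_coef /= factS natrM.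
rewrite (_ : k.+1%:R + nu + 1 = k%:R + (nu + 1) + 1); last first.
  by rewrite -natr1; ring.
rewrite -[k.+1%:R * _ * _]mulrA invfM [RHS]/GRing.opp /=.
set z := (_ * Gamma _)^-1; have k0 : k.+1%:R != 0 :> R by rewrite pnatr_eq0.
by rewrite exprS mulN1r mulNr mulrN [k.+1%:R * _]mulrCA mulVKf.
Qed.

Lemma is_cvg_clifford nu w : 0 <= nu -> cvgn (pseries (clifford_coef nu) w).
Proof.
move=> nu0; have g0 : 0 < Gamma (nu + 1) :> R by rewrite Gamma_gt0// lerDr.
apply: normed_cvg; rewrite /normed_series_of /=.
apply: (@series_le_cvg _ _ (fun k => (Gamma (nu + 1))^-1 * exp_coeff `|w| k)).
- by move=> n.
- by move=> n; rewrite mulr_ge0 ?invr_ge0 ?exp_coeff_ge0// ltW.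
- move=> n; rewrite /exp_coeff /= normrM normrX [_ ^+ n / _]mulrC mulrA.
  rewrite ler_wpM2r ?exprn_ge0//.
  have gn : Gamma (nu + 1) <= Gamma (n%:R + nu + 1) :> R by exact: Gamma_le_shift.
  have gn0 : 0 < Gamma (n%:R + nu + 1) :> R by apply: lt_le_trans gn.
  rewrite /clifford_coef normrM normrX normrN1 expr1n mul1r invfM normrM.
  rewrite !ger0_norm ?invr_ge0 ?ler0n ?(ltW gn0)//.
  rewrite mulrC ler_wpM2r ?invr_ge0// lef_pV2 ?posrE//.
- rewrite (_ : (fun k => _) = (Gamma (nu + 1))^-1 *: exp_coeff `|w|)//.
  exact/is_cvg_seriesZ/is_cvg_series_exp_coeff.
Qed.

Lemma pseriesN (f : R^nat) w : pseries (- f) w = - pseries f w.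
Proof.
apply/funext => n; rewrite /pseries /series /=; rewrite [RHS]/GRing.opp /=.
by rewrite -sumrN; apply: eq_bigr => k _; rewrite mulNr.
Qed.

Lemma is_derive_clifford nu w : 0 <= nu ->
  is_derive w 1 (clifford nu) (- clifford (nu + 1) w).
Proof.
move=> nu0; have nu1 : 0 <= nu + 1 by rewrite addr_ge0.
have nu2 : 0 <= nu + 1 + 1 by rewrite addr_ge0.
rewrite (_ : - _ = limn (pseries (pseries_diffs (clifford_coef nu)) w)).
  apply: (@pseries_snd_diffs _ _ (`|w| + 1)).
  - exact: is_cvg_clifford.
  - by rewrite pseries_diffs_clifford pseriesN; apply: is_cvgN; exact: is_cvg_clifford.
  - rewrite pseries_diffs_clifford pseries_diffsN pseries_diffs_clifford opprK.
    exact: is_cvg_clifford.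
  - by rewrite [ltRHS]ger0_norm ?addr_ge0// ltrDl.
rewrite pseries_diffs_clifford pseriesN limN//; exact: is_cvg_clifford.
Qed.

(** The three-term recurrence of Bessel functions, which is Bessel's equation
    once [clifford (nu + 1)] is read as minus the derivative of
    [clifford nu]. *)
Lemma clifford_recurrence nu w : 0 <= nu ->
  w * - clifford (nu + 1 + 1) w + (nu + 1) * clifford (nu + 1) w = clifford nu w.
Proof.
move=> nu0; have nu1 : 0 <= nu + 1 by rewrite addr_ge0.
have nu2 : 0 <= nu + 1 + 1 by rewrite addr_ge0.
have cd : cvgn (pseries (pseries_diffs (clifford_coef (nu + 1))) w).
  by rewrite pseries_diffs_clifford pseriesN; apply: is_cvgN; exact: is_cvg_clifford.
have := pseries_diffs_equiv cd.
rewrite pseries_diffs_clifford pseriesN limN; last exact: is_cvg_clifford.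
rewrite -/(clifford _ _); set s := series _ => cs.
apply/esym/cvg_lim => //.
rewrite (_ : pseries _ _ = w *: s + (nu + 1) *: pseries (clifford_coef (nu + 1)) w).
  apply: cvgD; first exact: cvgZr cs.
  by apply: cvgZr; exact: is_cvg_clifford.
apply/funext => n; rewrite /s /pseries /series /= !fctE /GRing.scale /=.
rewrite !mulr_sumr -big_split /=; apply: eq_bigr => k _.
rewrite clifford_coefS//; case: k => [|k] /=; first by rewrite !mul0r mulr0; ring.
by rewrite exprS; ring.
Qed.

(** Multiplied by [t ^ (a - 1)], the hypothesis says that [t ^ a * U t] is
    nondecreasing, and this function vanishes at [0]. *)
Lemma ge0_euler_ineq (U dU : R -> R) (a b : R) : 0 < a ->
  (forall t : R, is_derive t 1 U (dU t)) ->
  (forall t, 0 <= t <= b -> 0 <= t * dU t + a * U t) ->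
  forall t, 0 <= t <= b -> 0 <= U t.
Proof.
move=> a0 dUE H t /andP[]; rewrite le_eqVlt => /predU1P[<- b0|t0 tb].
  have := H 0; rewrite lexx b0 mul0r add0r => /(_ isT).
  by rewrite pmulr_rge0.
pose f (s : R) := s `^ a * U s.
have df (s : R) : 0 < s -> is_derive s 1 f (a * s `^ (a - 1) * U s + s `^ a * dU s).
  by move=> s0; apply: is_derive1M => //; exact: is_derive1_powR.
have Ucont : continuous U by move=> s; exact: is_derive1_continuous.
have fc : {within `[0, t], continuous f}.
  apply/(continuous_within_itvP _ t0); split.
  - move=> s; rewrite in_itv => /andP[s0 _].
    by apply: (is_derive1_continuous (df _ s0)).
  - apply: cvgM; first by apply: powR_cvg_at0; exact: ltW.
    by apply: cvg_at_right_filter; exact: Ucont.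
  - by apply: cvg_at_left_filter; exact: (is_derive1_continuous (df _ t0)).
have := @ger0_derive1_le_cc _ f 0 t _ _ fc 0 t.
rewrite /f powR0 ?gt_eqF// mul0r pmulr_rge0 ?powR_gt0//; apply.
- by move=> s; rewrite in_itv => /andP[s0 _]; have [] := df _ s0.
- move=> s; rewrite in_itv/= => /andP[s0 st]; rewrite derive1E.
  have [_ ->] := df _ s0.
  rewrite -[in s `^ a]mulr_powRB1 ?(ltW s0)//.
  rewrite (_ : _ + _ = s `^ (a - 1) * (s * dU s + a * U s)); last by ring.
  by rewrite mulr_ge0 ?powR_ge0// H// (ltW s0)/= (le_trans (ltW st)).
- by rewrite in_itv/= lexx ltW.
- by rewrite in_itv/= lexx ltW.
- exact: ltW.
Qed.

(** Two terms of the power series of the quotient of two consecutive Bessel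
    functions. Each comparison is obtained from the previous one, because the
    Euler operator [t d/dt + nu + 1] maps [clifford (nu + 1)] to
    [clifford nu]. *)
Lemma clifford_quotient_lb nu (b : R) : 0 <= nu ->
  (forall t, 0 <= t <= b -> 0 < clifford nu t) ->
  forall t, 0 <= t <= b ->
  (1 / (nu + 1) + t / ((nu + 1) ^+ 2 * (nu + 2))) * clifford nu t
    <= clifford (nu + 1) t.
Proof.
move=> nu0 Y0; have nu1 : 0 < nu + 1 by rewrite ltr_pwDr.
have nu2 : 0 < nu + 2 by rewrite ltr_pwDr.
have nu1' := ltW nu1.
pose Y0' := clifford nu; pose Y1 := clifford (nu + 1).
have dY0 (t : R) : is_derive t 1 Y0' (- Y1 t) by exact: is_derive_clifford.
have dY1 (t : R) : is_derive t 1 Y1 (- clifford (nu + 1 + 1) t).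
  by apply: is_derive_clifford.
have rec t : t * - clifford (nu + 1 + 1) t + (nu + 1) * Y1 t = Y0' t.
  exact: clifford_recurrence.
have Y1ge0 t : 0 <= t <= b -> 0 <= Y1 t.
  by apply: (ge0_euler_ineq nu1 dY1) => {}t tb; rewrite rec ltW// Y0.
pose U2 t := Y1 t - (nu + 1)^-1 * Y0' t.
have dU2 (t : R) : is_derive t 1 U2
    (- clifford (nu + 1 + 1) t - (nu + 1)^-1 * - Y1 t).
  exact: is_derive1B (dY1 t) (is_derive1Z _ (dY0 t)).
have U2ge0 t : 0 <= t <= b -> 0 <= U2 t.
  apply: (ge0_euler_ineq nu1 dU2) => {}t tb.
  rewrite (_ : _ + _ = t * (nu + 1)^-1 * Y1 t); last first.
    rewrite /U2 -(rec t); move: (Y1 t) (clifford _ t) => u v; field.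
    by rewrite gt_eqF.
  by move: (tb) => /andP[t0 _]; rewrite !mulr_ge0 ?invr_ge0 ?Y1ge0.
pose k := ((nu + 1) ^+ 2 * (nu + 2))^-1.
have k0 : 0 <= k by rewrite invr_ge0 mulr_ge0 ?exprn_ge0// ltW.
pose U3 t := U2 t - k * (t * Y0' t).
have dU3 (t : R) : is_derive t 1 U3
    ((- clifford (nu + 1 + 1) t - (nu + 1)^-1 * - Y1 t)
     - k * (1 * Y0' t + t * - Y1 t)).
  exact: is_derive1B (dU2 t) (is_derive1Z k (is_derive1M (is_derive_id t 1) (dY0 t))).
move=> t tb; rewrite -subr_ge0.
rewrite (_ : _ - _ = U3 t); last first.
  rewrite /U3 /U2 -/(Y0' t) -/(Y1 t) /k; move: (Y0' t) (Y1 t) => u v; field.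
  by rewrite !gt_eqF.
apply: (ge0_euler_ineq nu1 dU3) tb => {}t tb.
rewrite (_ : _ + _ = t * (nu + 1)^-1 * U2 t + k * t ^+ 2 * Y1 t); last first.
  rewrite /U3 /U2 -(rec t) /k; move: (Y1 t) (clifford _ t) => u v; field.
  by rewrite !gt_eqF.
move: (tb) => /andP[t0 _].
apply: addr_ge0.
  by apply: mulr_ge0 (U2ge0 _ tb); rewrite mulr_ge0 ?invr_ge0.
by apply: mulr_ge0 (Y1ge0 _ tb); rewrite mulr_ge0 ?sqr_ge0.
Qed.

Lemma besselJE nu (x : R) : 0 <= nu -> 0 < x ->
  besselJ nu x = (x / 2) `^ nu * clifford nu ((x / 2) ^+ 2).
Proof.
move=> nu0 x0; have x20 : 0 < x / 2 by rewrite divr_gt0.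
rewrite /besselJ (_ : (fun k => _) = (x / 2) `^ nu *:
  (fun k => clifford_coef nu k * ((x / 2) ^+ 2) ^+ k)).
  by rewrite lim_seriesZ//; exact: is_cvg_clifford.
apply/funext => k; rewrite /GRing.scale/= /GRing.scale/=.
rewrite powRD; last by rewrite (gt_eqF x20) implybT.
rewrite powRrM powR_mulrn ?powR_ge0// powR_mulrn ?(ltW x20)//.
by rewrite /clifford_coef; ring.
Qed.

Lemma derive1_besselJ nu (x : R) : 0 <= nu -> 0 < x ->
  derive1 (besselJ nu) x =
    nu / 2 * (x / 2) `^ (nu - 1) * clifford nu ((x / 2) ^+ 2) -
    (x / 2) `^ (nu + 1) * clifford (nu + 1) ((x / 2) ^+ 2).
Proof.
move=> nu0 x0; rewrite derive1E.
have x20 : 0 < x / 2 by rewrite divr_gt0.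
have d2 : is_derive x 1 (fun t : R => t / 2) (1 / 2).
  rewrite (_ : (fun t : R => t / 2) = (fun t => 2^-1 * t)); last first.
    by apply/funext => t; rewrite mulrC.
  by rewrite mul1r -[X in is_derive _ _ _ X]mulr1; exact: is_derive1Z.
have d3 : is_derive x 1 (fun t : R => (t / 2) ^+ 2) (x / 2).
  by apply: is_derive_eq (is_derive1M d2 d2) _; field.
have d4 : is_derive x 1 (fun t => (t / 2) `^ nu) (nu * (x / 2) `^ (nu - 1) * (1 / 2)).
  by apply: (@is_derive1_comp _ (fun t => t `^ nu) (fun t => t / 2)); exact: is_derive1_powR.
have d5 : is_derive x 1 (fun t => clifford nu ((t / 2) ^+ 2))
    (- clifford (nu + 1) ((x / 2) ^+ 2) * (x / 2)).
  apply: (@is_derive1_comp _ (clifford nu) (fun t => (t / 2) ^+ 2)).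
  exact: is_derive_clifford.
have := is_derive1M d4 d5; move=> d6.
have := @near_eq_is_derive _ _ _ _ (besselJ nu) _ _ _ _ d6.
case.
  near=> t; rewrite besselJE//; near: t; exact: lt_nbhsr.
move=> _ ->; rewrite (@powRD _ _ nu 1) ?powRr1 ?(ltW x20)//; last first.
  by rewrite (gt_eqF x20) implybT.
move: (clifford nu _) (clifford (nu + 1) _) => u v.
by field.
Unshelve. all: by end_near. Qed.

(** With [p := (1 + nu * m) / 2] and [w := (c / m) ^ 2], the equation that
    defines [c] reads [(p - lambda) * clifford nu w = m * w * clifford (nu + 1) w].
    Since [2 * c / m] lies before the first zero of the Bessel function,
    [clifford nu] is positive on [[0, w]], and the lower bound for the quotient
    of consecutive Bessel functions bounds [c] from above: [X] and
    [X ^ 2 / (m * (nu + 2))] are its linear and quadratic terms. *)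
Lemma bessel_root_bound (nu m lambda c : R) : 0 < m -> 0 <= nu ->
  bessel_root nu m lambda c ->
  let X := c ^+ 2 / (m * (1 + nu)) in
  0 < X /\ X + X ^+ 2 / (m * (nu + 2)) <= (1 + nu * m) / 2 - lambda.
Proof.
move=> m0 nu0 [j [[j0 Jj] jlb]] [[eqn x0 xj] _] X.
set x := 2 / m * c in eqn x0 xj.
have c0 : 0 < c by move: x0; rewrite /x pmulr_rgt0// divr_gt0.
have nu1 : 0 < nu + 1 by rewrite ltr_pwDr.
have nu2 : 0 < nu + 2 by rewrite ltr_pwDr.
have y0 : 0 < x / 2 by rewrite divr_gt0.
have xE : c = m * (x / 2) by rewrite /x; field; rewrite gt_eqF.
set y := x / 2 in y0 xE.
have Ypos t : 0 <= t <= y ^+ 2 -> 0 < clifford nu t.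
  move=> /andP[t0 ty]; rewrite ltNge; apply/negP => Yt.
  have Y00 : 0 < clifford nu 0.
    have -> : clifford nu 0 = (Gamma (nu + 1))^-1.
      apply/cvg_lim => //; rewrite -(cvg_shiftn 1).
      rewrite (_ : (fun n => _) = cst (Gamma (nu + 1))^-1); first exact: cvg_cst.
      apply/funext => n; rewrite /pseries /series /= addn1 big_nat_recl//= big1.
        by rewrite /clifford_coef !expr0 fact0 add0r; field; rewrite gt_eqF ?Gamma_gt0// lerDr.
      by move=> i _; rewrite exprS mul0r mulr0.
    by rewrite invr_gt0 Gamma_gt0// lerDr.
  have [|||z] := @IVT _ (clifford nu) 0 t 0 => //.
  - apply: continuous_subspaceT => s.
    exact: (is_derive1_continuous (is_derive_clifford s nu0)).
  - by rewrite ge_min le_max Yt (ltW Y00) orbT.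
  rewrite in_itv/= => /andP[z0 zt] Yz.
  have zn0 : 0 < z.
    rewrite lt_neqAle z0 andbT eq_sym; apply/eqP => zE.
    by move: Yz; rewrite zE => Yz; rewrite Yz ltxx in Y00.
  (* a zero [z] of [clifford nu] is a zero [2 * sqrt z] of the Bessel function *)
  pose r := 2 * Num.sqrt z.
  have r0 : 0 < r by rewrite mulr_gt0 ?sqrtr_gt0.
  have rE : r / 2 = Num.sqrt z by rewrite /r; field.
  have := jlb r; rewrite /= r0 besselJE// rE sqr_sqrtr// Yz mulr0 => /(_ (conj isT erefl)).
  apply/negP; rewrite -ltNge; apply: le_lt_trans xj.
  have -> : x = 2 * y by rewrite /y; field.
  rewrite /r ler_pM2l// -(@ger0_norm _ y) ?(ltW y0)// -sqrtr_sqr ler_sqrt ?exprn_ge0 ?(ltW y0)//.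
  exact: le_trans zt ty.
have y2 : 0 <= y ^+ 2 <= y ^+ 2 by rewrite lexx sqr_ge0.
have Q := clifford_quotient_lb nu0 Ypos y2.
have Yy := Ypos _ y2.
move: eqn; rewrite besselJE// derive1_besselJ// -/y.
rewrite (@powRD _ _ nu 1) ?powRr1 ?(ltW y0)//; last by rewrite (gt_eqF y0) implybT.
have yn : y != 0 by rewrite gt_eqF.
rewrite (@powRB _ y nu 1) ?powRr1 ?(ltW y0)//; last by rewrite yn implybT.
have := powR_gt0 nu y0; set q := y `^ nu.
move: Q Yy; set Y := clifford nu _; set Y1 := clifford _ _ => Q Yy q0 eqn.
have eq2 : ((1 + nu * m) / 2 - lambda) * Y = m * y ^+ 2 * Y1.
  apply: (mulfI (lt0r_neq0 q0)); apply/eqP; rewrite -subr_eq0.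
  apply/eqP; rewrite -[RHS](mul0r 2^-1) -eqn xE.
  move: q Y Y1 {eqn q0 Q Yy} => u v w; field.
  exact: yn.
clearbody Y Y1.
split.
  by apply: divr_gt0; [exact: exprn_gt0|rewrite addrC; exact: mulr_gt0].
have -> : X + X ^+ 2 / (m * (nu + 2)) =
    m * y ^+ 2 * (1 / (nu + 1) + y ^+ 2 / ((nu + 1) ^+ 2 * (nu + 2))).
  by rewrite /X xE addrC; field; rewrite ?(addrC 1) !gt_eqF.
rewrite -(ler_pM2r Yy) eq2 -(mulrA (m * y ^+ 2)) ler_wpM2l//.
by rewrite mulr_ge0 ?sqr_ge0 ?ltW.
Qed.

End clifford_theory.

(** * Lebesgue measure on row vectors *)

Section lebesgue_rV_theory.
Context {R : realType}.
Local Notation lambda := (@lebesgue_measure R).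

Lemma measurable_translate_real (c : R) :
  measurable_fun setT (fun t : measurableTypeR R => t + c : measurableTypeR R).
Proof. exact: measurable_funD. Qed.

Lemma lebesgue_measure_translate (c : R) (A : set (measurableTypeR R)) :
  measurable A -> lambda ((fun t => t + c) @^-1` A) = lambda A.
Proof.
move=> mA.
pose f : measurableTypeR R -> measurableTypeR R := fun t => t + c.
have mf : measurable_fun setT f by exact: measurable_translate_real.
transitivity (pushforward lambda f A) => //.
apply/esym/lebesgue_measure_unique => //= _ [[a b]] _ <-.
rewrite /pushforward.
rewrite (_ : f @^-1` _ = `]a - c, b - c]%classic); last first.
  apply/seteqP; split => t; rewrite /= !in_itv/= /f.
    by move=> /andP[at_ tb]; rewrite ltrBlDr at_ lerBrDr.
  by rewrite ltrBlDr lerBrDr.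
rewrite !lebesgue_measure_itv/= !lte_fin ltrD2r.
by case: ifP => // _; rewrite -!EFinB; congr EFin; ring.
Qed.

Lemma measurable_translate n (v : 'rV[R]_n) :
  measurable_fun setT (fun x : 'rV[R]_n => x + v).
Proof.
apply: measurable_rV_comp => i.
rewrite (_ : (fun t => _) = (fun x : 'rV[R]_n => x ord0 i + v ord0 i)); last first.
  by apply/funext => x; rewrite mxE.
by apply: measurable_funD => //; exact: measurable_coor.
Qed.

(** By induction on the dimension: the coordinate that [cons_rV] adds is translated
    inside the inner one-dimensional measure, the others in the outer integral. *)
Lemma lebesgue_rV_translate n (v : 'rV[R]_n) (A : set 'rV[R]_n) :
  measurable A -> lebesgue_rV R n ((fun x => x + v) @^-1` A) = lebesgue_rV R n A.
Proof.
elim: n v A => [|n IH] v A mA.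
  have xv (x : 'rV[R]_0) : x + v = x by apply/rowP => -[].
  by congr (lebesgue_rV R 0 _); apply/seteqP; split => x /=; rewrite xv.
pose v' : 'rV[R]_n := \row_i v ord0 (lift ord0 i).
pose C := @cons_rV R n @^-1` A.
have mC : measurable C.
  by rewrite -[X in measurable X]setTI; exact: measurable_cons_rV.
rewrite /= /cons_measure /pushforward /product_measure1 -/C.
have E y : lambda (xsection (@cons_rV R n @^-1` ((fun x => x + v) @^-1` A)) y) =
    lambda (xsection C (y + v')).
  rewrite -(@lebesgue_measure_translate (v ord0 ord0) (xsection C (y + v'))); last first.
    exact: measurable_xsection.
  congr (lambda _); apply/seteqP.
  have K t : cons_rV (y, t) + v = cons_rV (y + v', t + v ord0 ord0).
    apply/rowP => i; rewrite !mxE; case: unliftP => [j ->|->] //=.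
    by rewrite !mxE.
  split => t; rewrite /xsection /= !inE /C /=; first by rewrite K.
  by rewrite K.
under eq_integral do rewrite /= E.
pose f : 'rV[R]_n -> 'rV[R]_n := fun y => y + v'.
have mf : measurable_fun setT f by exact: measurable_translate.
transitivity (\int[pushforward (lebesgue_rV R n) f]_y (lambda \o xsection C) y)%E.
  rewrite [RHS]ge0_integral_pushforward//.
  exact: measurable_fun_xsection.
apply: eq_measure_integral => B mB _ /=.
by rewrite /pushforward; exact: IH.
Qed.

Lemma ge0_integral_translate n (v : 'rV[R]_n) (f : 'rV[R]_n -> \bar R) :
  measurable_fun setT f -> (forall x, 0 <= f x)%E ->
  (\int[lebesgue_rV R n]_x f (x + v)%R = \int[lebesgue_rV R n]_x f x)%E.
Proof.
move=> mf f0; have mt := measurable_translate v.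
transitivity (\int[pushforward (lebesgue_rV R n) (fun x => (x + v)%R)]_y f y)%E.
  by rewrite [RHS]ge0_integral_pushforward.
apply: eq_measure_integral => B mB _ /=.
by rewrite /pushforward; exact: lebesgue_rV_translate.
Qed.

(** Every open set is the union of the rational boxes that it contains. *)
Lemma open_measurable_rV n (U : set 'rV[R]_n) : open U -> measurable U.
Proof.
move=> oU.
pose box (p : 'rV[rat]_n * nat) : set 'rV[R]_n :=
  [set x | forall i, x ord0 i \in `]ratr (p.1 ord0 i) - p.2.+1%:R^-1,
                                    ratr (p.1 ord0 i) + p.2.+1%:R^-1[].
pose F (k : nat) : set 'rV[R]_n :=
  if unpickle k is Some p then (if `[< box p `<=` U >] then box p else set0) else set0.
have mbox p : measurable (box p).
  rewrite (_ : box p = \bigcap_(i in [set: 'I_n]) ((fun x : 'rV[R]_n =>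
    x ord0 i : measurableTypeR R) @^-1` [set` `]ratr (p.1 ord0 i) - p.2.+1%:R^-1,
      ratr (p.1 ord0 i) + p.2.+1%:R^-1[])).
    apply: fin_bigcap_measurable => // i _.
    by rewrite -[X in measurable X]setTI; apply: measurable_coor => //;
      exact: measurable_itv.
  by apply/seteqP; split => x H i; [move=> _; exact: H|exact: (H i)].
rewrite (_ : U = \bigcup_k F k); last first.
  apply/seteqP; split => [x Ux|x [k _]]; last first.
    by rewrite /F; case: unpickle => // p; case: ifPn => // /asboolP; apply.
  have /nbhs_ballP[e /= e0 eU] : nbhs x U by exact: open_nbhs_nbhs.
  have [k ke] : exists k : nat, k.+1%:R^-1 < e / 2.
    have := near_infty_natSinv_lt (PosNum (divr_gt0 e0 (@ltr0n R 2))).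
    by move=> [N _ /(_ N (leqnn N))] h; exists N.
  have k0 : 0 < k.+1%:R^-1 :> R by rewrite invr_gt0.
  have rq i : exists q : rat, ratr q \in `]x ord0 i - k.+1%:R^-1, x ord0 i + k.+1%:R^-1[.
    by apply: rat_in_itvoo; rewrite ltrD2l gtrN.
  pose q := \row_i projT1 (cid (rq i)).
  have qP i : ratr (q ord0 i) \in `]x ord0 i - k.+1%:R^-1, x ord0 i + k.+1%:R^-1[.
    by rewrite mxE; exact: projT2 (cid (rq i)).
  exists (pickle (q, k)) => //; rewrite /F pickleK.
  have bU : box (q, k) `<=` U.
    move=> y yb; apply: eU; split => // i0 i; have -> : i0 = ord0 by apply/val_inj; case: i0 => -[].
    move: (yb i) (qP i); rewrite /= !in_itv/= => /andP[h1 h2] /andP[h3 h4].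
    rewrite /ball/= ltr_norml; move: h1 h2 h3 h4 ke.
    move: (ratr _) (k.+1%:R^-1) (x ord0 i) (y ord0 i) => a b u w h1 h2 h3 h4 ke.
    by apply/andP; split; lra.
  rewrite asboolT//= => i; move: (qP i); rewrite /= !in_itv/= => /andP[h1 h2].
  move: h1 h2; move: (ratr _) (k.+1%:R^-1) (x ord0 i) => a b u h1 h2.
  by apply/andP; split; lra.
apply: bigcupT_measurable => k; rewrite /F; case: unpickle => // p.
by case: ifP => _; [exact: mbox|exact: measurable0].
Qed.

Lemma open_continuous_measurable_rV n (D : set 'rV[R]_n) (f : 'rV[R]_n -> R) :
  open D -> {in D, continuous f} -> measurable_fun D f.
Proof.
move=> oD cf; apply: (measurability _ (RGenOpens.measurableE R)).
move=> _ [B [a [b ->]] <-]; apply: open_measurable_rV.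
rewrite openE => x [Dx fx]; apply: filterI; first exact: open_nbhs_nbhs.
have := cf x (mem_set Dx); apply; apply: open_nbhs_nbhs.
by split => //; exact: interval_open.
Qed.

(** Bounded measurable sets of known finite measure, used to dominate functions
    with compact support. *)
Definition cube n (M : R) : set 'rV[R]_n := [set x | forall i, `|x ord0 i| <= M].

Lemma measurable_cube n (M : R) : measurable (@cube n M).
Proof.
rewrite (_ : @cube n M = \bigcap_(i in [set: 'I_n]) ((fun x : 'rV[R]_n =>
  x ord0 i : measurableTypeR R) @^-1` [set` `[- M, M]])).
  apply: fin_bigcap_measurable => // i _.
  by rewrite -[X in measurable X]setTI; apply: measurable_coor => //;
    exact: measurable_itv.
apply/seteqP; split => x H i; first by move=> _; rewrite /= in_itv/= -ler_norml; exact: H.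
by have := H i I; rewrite /= in_itv/= -ler_norml.
Qed.

Lemma lebesgue_rV_cube_fin n (M : R) : 0 <= M ->
  (lebesgue_rV R n (@cube n M) < +oo)%E.
Proof.
move=> M0; rewrite (_ : @cube n M =
  [set x | forall i, x ord0 i \in `[(const_mx (- M) : 'rV[R]_n) ord0 i,
                                    (const_mx M : 'rV[R]_n) ord0 i]]).
  by rewrite lebesgue_rV_box ?ltry// => i; rewrite !mxE; lra.
by apply/seteqP; split => x H i; have := H i; rewrite !mxE in_itv/= ler_norml.
Qed.

End lebesgue_rV_theory.

(** * Distance to the boundary of a convex set *)

Lemma ler_norm_coord (R : realType) (n : nat) (v : 'rV[R]_n) i :
  `|v ord0 i| <= `|v|.
Proof.
rewrite [leRHS]/Num.Def.normr /= mx_normrE.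
by apply/bigmax_geP; right; exists (ord0, i).
Qed.

Section dot_product.
Context {R : realType} {n : nat}.
Implicit Types (u v w x y z : 'rV[R]_n) (k : R).

Definition dot u v : R := \sum_i u ord0 i * v ord0 i.

Lemma dotC u v : dot u v = dot v u.
Proof. by apply: eq_bigr => i _; rewrite mulrC. Qed.

Lemma dotDr u v w : dot u (v + w) = dot u v + dot u w.
Proof. by rewrite -big_split; apply: eq_bigr => i _; rewrite mxE mulrDr. Qed.

Lemma dotZr k u v : dot u (k *: v) = k * dot u v.
Proof. by rewrite mulr_sumr; apply: eq_bigr => i _; rewrite mxE mulrCA. Qed.

Lemma dotNr u v : dot u (- v) = - dot u v.
Proof. by rewrite -scaleN1r dotZr mulN1r. Qed.

Lemma dotBr u v w : dot u (v - w) = dot u v - dot u w.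
Proof. by rewrite dotDr dotNr. Qed.

Lemma dotDl u v w : dot (v + w) u = dot v u + dot w u.
Proof. by rewrite dotC dotDr !(dotC u). Qed.

Lemma dotZl k u v : dot (k *: v) u = k * dot v u.
Proof. by rewrite dotC dotZr dotC. Qed.

Lemma dotNl u v : dot (- v) u = - dot v u.
Proof. by rewrite dotC dotNr dotC. Qed.

Lemma dotBl u v w : dot (v - w) u = dot v u - dot w u.
Proof. by rewrite dotDl dotNl. Qed.

Definition dotE := (dotDr, dotBr, dotNr, dotZr, dotDl, dotBl, dotNl, dotZl).

Lemma dot_ge0 u : 0 <= dot u u.
Proof. by apply: sumr_ge0 => i _; rewrite -expr2 sqr_ge0. Qed.

Lemma enormE u : enorm u = Num.sqrt (dot u u).
Proof. by congr Num.sqrt; apply: eq_bigr => i _; rewrite expr2. Qed.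

Lemma enorm_ge0 u : 0 <= enorm u.
Proof. exact: sqrtr_ge0. Qed.

Lemma sqr_enorm u : enorm u ^+ 2 = dot u u.
Proof. by rewrite enormE sqr_sqrtr ?dot_ge0. Qed.

Lemma enormZ k u : enorm (k *: u) = `|k| * enorm u.
Proof. by rewrite !enormE !dotE mulrA -expr2 sqrtrM ?sqr_ge0// sqrtr_sqr. Qed.

Lemma coord_le_enorm u i : `|u ord0 i| <= enorm u.
Proof.
rewrite -sqrtr_sqr /enorm ler_sqrt ?sumr_ge0// => [|j _]; last exact: sqr_ge0.
rewrite (bigD1 i)//= lerDl sumr_ge0// => j _; exact: sqr_ge0.
Qed.

Lemma continuous_coordB x i :
  continuous (fun z : 'rV[R]_n => x ord0 i - z ord0 i).
Proof.
move=> z.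
apply: (@continuousB _ _ _ (cst (x ord0 i)) (fun z : 'rV[R]_n => z ord0 i)).
  exact: cst_continuous.
exact: coord_continuous.
Qed.

Lemma continuous_enormB x : continuous (fun z : 'rV[R]_n => enorm (x - z)).
Proof.
have c2 i : continuous (fun z : 'rV[R]_n => (x - z) ord0 i ^+ 2).
  rewrite (_ : (fun z : 'rV[R]_n => _) =
    (fun z => (x ord0 i - z ord0 i) * (x ord0 i - z ord0 i))).
    move=> z; have c1 := @continuous_coordB x i z.
    exact: (@continuousM _ _ _ _ _ c1 c1).
  by apply/funext => z; rewrite expr2 !mxE.
have c3 : continuous (fun z : 'rV[R]_n => \sum_i (x - z) ord0 i ^+ 2).
  by apply: continuous_big; [exact: add_continuous|move=> i _; exact: c2].
move=> z; exact: (@continuous_comp _ _ _ _ (@Num.sqrt R) z (c3 z) (@sqrt_continuous R _)).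
Qed.

End dot_product.

Section distance.
Context {R : realType} {n : nat}.
Variable Omega : set 'rV[R]_n.
Hypothesis Omega_open : open Omega.
Hypothesis Omega_convex : convex_set Omega.
Implicit Types x y z u : 'rV[R]_n.

Lemma convex_comb x y (s t : R) : Omega x -> Omega y -> 0 <= s -> 0 <= t ->
  s + t = 1 -> Omega (s *: x + t *: y).
Proof.
move=> Ox Oy s0 t0 st; have s1 : s <= 1 by rewrite -st lerDl.
have <- : 1 - s = t by rewrite -st addrC addKr.
exact: set_mem (Omega_convex (Itv01 s0 s1) (mem_set Ox) (mem_set Oy)).
Qed.

Lemma boundary_notin y : boundary Omega y -> ~ Omega y.
Proof. by move=> [_]; move/interior_id : Omega_open => ->. Qed.

(** Take for [p] the first point outside [Omega] on the segment from [z] to [u]. *)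
Lemma segment_meets_boundary z u : Omega z -> ~ Omega u ->
  exists2 p, boundary Omega p & enorm (z - p) <= enorm (z - u).
Proof.
move=> Oz Ou.
pose g (t : R) := z + t *: (u - z).
have gc : continuous g.
  move=> t; apply: cvgD; first exact: cvg_cst.
  by apply: cvgZl; exact: cvg_id.
pose C := `[0%R, 1%R]%classic `&` g @^-1` (~` Omega).
have cC : compact C.
  apply: (subclosed_compact _ (@segment_compact R 0 1)); last by move=> ? [].
  apply: closedI; first exact: interval_closed.
  by apply: preimage_closed; [move=> t _; exact: gc|exact: open_closedC].
have C1 : C 1.
  by split; rewrite /= ?in_itv/= ?ler01 ?lexx// /g scale1r addrC subrK.
have [|T] := @compact_EVT_min _ R id C (ex_intro _ 1 C1) cC.
  by apply: continuous_subspaceT => t.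
rewrite inE => -[/=]; rewrite in_itv/= => /andP[T0 T1] OT Tmin.
have Tgt0 : 0 < T.
  rewrite lt_neqAle T0 andbT; apply/eqP => TE; apply: OT.
  by rewrite /g -TE scale0r addr0.
exists (g T); last first.
  rewrite /g opprD addrA subrr add0r -scalerN opprB enormZ ger0_norm//.
  by rewrite ler_piMl ?enorm_ge0.
split; last by move/interior_id : Omega_open => ->.
move=> B /(gc T)/= /nbhs_ballP[e /= e0 eB].
pose t := T - Num.min (e / 2) T.
have m0 : 0 < Num.min (e / 2) T by rewrite lt_min divr_gt0.
have t0 : 0 <= t by rewrite subr_ge0 ge_min lexx orbT.
have tT : t < T by rewrite /t gtrBl.
exists (g t); split; last first.
  apply: eB; rewrite /ball/= /t opprB addrC subrK gtr0_norm//.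
  by rewrite gt_min ltr_pdivrMr// ltr_pMr// ltr1n.
apply: contrapT => Ogt.
have := Tmin t; rewrite inE leNgt tT => /(_ _)/negP; apply => //.
by split => //=; rewrite in_itv/= t0 (le_trans (ltW tT)).
Qed.

Section nearest.
Variables (x : 'rV[R]_n).
Hypothesis Ox : Omega x.
Hypothesis boundary0 : boundary Omega !=set0.

Lemma nearest_boundary_point :
  exists2 y, boundary Omega y &
    forall z, boundary Omega z -> enorm (x - y) <= enorm (x - z).
Proof.
have [y0 by0] := boundary0.
pose K := boundary Omega `&` (fun z => enorm (x - z)) @^-1` [set t | t <= enorm (x - y0)].
have K0 : K !=set0 by exists y0; split => //=.
have cK : closed K.
  apply: closedI.
    by apply: closedI; [exact: closed_closure|apply: open_closedC; exact: open_interior].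
  apply: preimage_closed; last exact: closed_le.
  by move=> z _; exact: continuous_enormB.
have bK : bounded_set K.
  exists (`|x| + enorm (x - y0)); split; first exact: num_real.
  move=> M xM z [_ /= zy]; rewrite (le_trans _ (ltW xM))//.
  have -> : z = x - (x - z) by rewrite opprB addrC subrK.
  rewrite (le_trans (ler_normB _ _))// lerD2l.
  rewrite [leLHS]/Num.Def.normr /= mx_normrE; apply/bigmax_leP; split => [|[i j] _].
    exact: enorm_ge0.
  rewrite (le_trans _ zy)//= (_ : i = ord0); first exact: coord_le_enorm.
  by apply/val_inj; case: i => -[].
have [y] := @EVT_min_rV R n (fun z => enorm (x - z)) K K0
  (bounded_closed_compact bK cK) (continuous_subspaceT (@continuous_enormB _ _ x)).
rewrite inE => -[yb yy0] ymin; exists y => // z zb.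
have [zy0|/ltW zy0] := leP (enorm (x - z)) (enorm (x - y0)).
  by apply: ymin; rewrite inE; split.
exact: le_trans zy0.
Qed.

Lemma dist_boundaryP : exists y, [/\ boundary Omega y,
  fine (dist_boundary Omega x) = enorm (x - y),
  dist_boundary Omega x = (enorm (x - y))%:E &
  forall z, boundary Omega z -> enorm (x - y) <= enorm (x - z)].
Proof.
have [y yb ymin] := nearest_boundary_point.
have H : dist_boundary Omega x = (enorm (x - y))%:E.
  apply/eqP; rewrite eq_le; apply/andP; split.
    by apply: ereal_inf_lbound; exists y.
  by apply: le_ereal_inf_tmp => _ [z zb <-]; rewrite lee_fin ymin.
by exists y; split => //; rewrite H.
Qed.

Lemma dist_boundary_gt0 : 0 < fine (dist_boundary Omega x).
Proof.
have [y [yb -> _ _]] := dist_boundaryP.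
rewrite lt_neqAle enorm_ge0 andbT; apply/eqP => xy.
apply: (boundary_notin yb); suff <- : x = y by [].
apply/rowP => i; apply/eqP; rewrite -subr_eq0 -normr_le0 xy.
by have := coord_le_enorm (x - y) i; rewrite !mxE.
Qed.

Lemma dist_ball_subset u : enorm (x - u) < fine (dist_boundary Omega x) -> Omega u.
Proof.
move=> xu; apply: contrapT => Ou.
have [p pb xp] := segment_meets_boundary Ox Ou.
have [y [yb dE _ ymin]] := dist_boundaryP.
by move: xu; rewrite dE ltNge (le_trans (ymin _ pb) xp).
Qed.

End nearest.

(** The distance function lies below the linear function that measures the
    distance to the hyperplane orthogonal to [x - y], where [y] is a boundary
    point nearest to [x]: if [delta z] were larger, then [y] would be strictly
    between a point of the ball about [z] and a point of the ball about [x],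
    hence inside [Omega]. *)
Lemma dist_boundary_barrier x : Omega x -> boundary Omega !=set0 ->
  exists2 nu : 'rV[R]_n, dot nu nu = 1 &
    forall z, Omega z -> fine (dist_boundary Omega z) <=
      fine (dist_boundary Omega x) + dot nu (z - x).
Proof.
move=> Ox b0; have [y [yb dx _ ymin]] := dist_boundaryP x b0.
have r0 := dist_boundary_gt0 Ox b0; rewrite dx in r0 *.
set r := enorm (x - y) in r0 *.
have rr : dot (x - y) (x - y) = r ^+ 2 by rewrite sqr_enorm.
exists (r^-1 *: (x - y)).
  by rewrite !dotZl !dotZr rr; field; rewrite gt_eqF.
set nu := r^-1 *: (x - y).
have nu1 : dot nu nu = 1 by rewrite !dotZl !dotZr rr; field; rewrite gt_eqF.
have xyE : x - y = r *: nu by rewrite scalerA divff ?gt_eqF// scale1r.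
clearbody nu; move=> z Oz; rewrite leNgt; apply/negP => rho.
have hE : r + dot nu (z - x) = dot nu (z - y).
  rewrite -[in RHS](subrK x z) -addrA xyE [RHS]dotDr dotZr nu1; ring.
rewrite hE in rho; set h := dot nu (z - y) in hE rho.
set d := fine _ in rho.
have d0 : 0 < d by exact: dist_boundary_gt0.
have [tau [tau0 htau taud]] : exists tau, [/\ 0 <= tau, h < tau & tau < d].
  have [h0|h0] := ltP h 0; first by exists 0.
  by exists ((h + d) / 2); split; lra.
(* [z'] is in the ball about [z], and on the far side of the hyperplane *)
pose z' := z - tau *: nu.
have Oz' : Omega z'.
  apply: (dist_ball_subset Oz b0); rewrite -/d /z' opprB addrC subrK.
  by rewrite enormZ ger0_norm// enormE nu1 sqrtr1 mulr1.
pose w := y - z'.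
have wk : dot nu w = tau - h.
  rewrite /w /z' opprB addrCA [LHS]dotDr dotZr nu1 mulr1 /h.
  by rewrite -[y - z]opprB dotNr.
have k0 : 0 < dot nu w by rewrite wk subr_gt0.
set kap := dot nu w in wk k0.
(* small enough for [y + eps * w] to be in the open ball about [x] *)
pose eps := r * kap / (dot w w + 1).
have w1 : 0 < dot w w + 1 by rewrite ltr_wpDl ?dot_ge0.
have e0 : 0 < eps by rewrite divr_gt0 ?mulr_gt0.
pose q := y + eps *: w.
have Oq : Omega q.
  apply: (dist_ball_subset Ox b0); rewrite dx -/r.
  rewrite -(@ltr_pXn2r _ 2) ?nnegrE ?enorm_ge0 ?(ltW r0)// sqr_enorm.
  have -> : x - q = r *: nu - eps *: w by rewrite /q opprD addrA xyE.
  rewrite dotBr !dotBl !dotZr !dotZl nu1 (dotC w nu) -/kap.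
  have rk0 : 0 < r * kap by rewrite mulr_gt0.
  have ew : eps * dot w w < 2 * (r * kap).
    rewrite /eps mulrAC ltr_pdivrMr//.
    have := mulr_ge0 (ltW rk0) (dot_ge0 w).
    by move: (r * kap) (dot w w) rk0 => a b a0 ab; lra.
  have := ltr_pM2l e0 (eps * dot w w) (2 * (r * kap)); rewrite ew.
  by move: (dot w w) => b; lra.
apply: (boundary_notin yb).
have -> : y = (1 + eps)^-1 *: q + (eps / (1 + eps)) *: z'.
  have e1 : 1 + eps != 0 by rewrite gt_eqF// ltr_wpDl.
  apply: (scalerI e1); rewrite scalerDr !scalerA divff// scale1r.
  rewrite (_ : (1 + eps) * (eps / (1 + eps)) = eps); last by field.
  rewrite /q /w -addrA -scalerDr subrK.
  by rewrite scalerDl scale1r.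
apply: convex_comb => //.
- by rewrite invr_ge0 ltW// ltr_wpDl.
- by rewrite divr_ge0// ltW// ltr_wpDl.
- by field; rewrite gt_eqF// ltr_wpDl.
Qed.

End distance.

(** * One-dimensional supersolutions *)

Section one_dimensional.
Context {R : realType}.

Section second_difference.
Variables (f f1 f2 : R -> R) (D : R).
Hypothesis df : forall t : R, 0 < t < D -> is_derive t 1 f (f1 t).
Hypothesis df1 : forall t : R, 0 < t < D -> is_derive t 1 f1 (- f2 t).

Let MVT_pos (k dk : R -> R) (a b : R) : 0 < a -> a <= b -> b < D ->
  (forall t : R, 0 < t < D -> is_derive t 1 k (dk t)) ->
  exists2 c, a <= c <= b & k b - k a = dk c * (b - a).
Proof.
move=> a0 ab bD dkE.
have dk' (t : R) : a <= t <= b -> is_derive t 1 k (dk t).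
  move=> /andP[t1 t2]; apply: dkE.
  by rewrite (lt_le_trans a0)//= (le_lt_trans t2).
have [||c] := @MVT_segment _ k dk a b ab.
- by move=> t; rewrite in_itv/= => /andP[t1 t2]; apply: dk'; rewrite !ltW.
- apply: derivable_within_continuous => t; rewrite in_itv/= => tab.
  by have [] := dk' _ tab.
- by rewrite in_itv/= => cab ->; exists c.
Qed.

(** [s |-> f s + L * s ^ 2 / 2] has a nonincreasing derivative on the interval. *)
Lemma second_difference_lb (L t h : R) : 0 < t - `|h| -> t + `|h| < D ->
  (forall r, t - `|h| <= r <= t + `|h| -> L <= f2 r) ->
  L * h ^+ 2 <= 2 * f t - f (t + h) - f (t - h).
Proof.
wlog h0 : h / 0 <= h.
  move=> H; have [|/ltW h0] := leP 0 h; first exact: H.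
  move=> th1 th2 Lf; have := H (- h); rewrite oppr_ge0 normrN sqrrN opprK.
  by move=> /(_ h0 th1 th2 Lf); lra.
rewrite ger0_norm// => th1 th2 Lf.
pose k s := f s + L / 2 * (s * s).
pose k1 s := f1 s + L * s.
have dk (s : R) : 0 < s < D -> is_derive s 1 k (k1 s).
  move=> sD; have d1 := is_derive1M (is_derive_id s 1) (is_derive_id s 1).
  have d2 := is_derive1D (df sD) (is_derive1Z (L / 2) d1).
  by apply: is_derive_eq d2 _; rewrite /k1; field.
have dk1 (s : R) : 0 < s < D -> is_derive s 1 k1 (- f2 s + L).
  move=> sD; have d2 := is_derive1D (df1 sD) (is_derive1Z L (is_derive_id s 1)).
  by apply: is_derive_eq d2 _; rewrite mulr1.
have t0 : 0 < t by lra.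
have tD : t < D by lra.
have [|c1 /andP[c11 c12] E1] := @MVT_pos k k1 (t - h) t th1 _ tD dk; first by lra.
have [|c2 /andP[c21 c22] E2] := @MVT_pos k k1 t (t + h) t0 _ th2 dk; first by lra.
have [|||c3 /andP[c31 c32] E3] := @MVT_pos k1 (fun s => - f2 s + L) c1 c2 _ _ _ dk1.
- by lra.
- by lra.
- by lra.
have Lc : L <= f2 c3 by apply: Lf; apply/andP; split; lra.
have c12' : 0 <= c2 - c1 by lra.
have k12 : k1 c2 <= k1 c1.
  have : 0 <= (f2 c3 - L) * (c2 - c1) by rewrite mulr_ge0// subr_ge0.
  by move: E3; lra.
have : 0 <= (k1 c1 - k1 c2) * h by rewrite mulr_ge0// subr_ge0.
by move: E1 E2; rewrite /k; lra.
Qed.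

End second_difference.

Section supersolution.
Variables (a b beta m : R).
Hypothesis m0 : 0 < m.

(** The positive function whose logarithmic derivative is
    [(a - b * beta * t ^ m) / t]. Its second derivative is
    [- ssol * ssol_potential]; where [beta * t ^ m <= 1], this potential
    dominates a combination of [1 / t ^ 2] and [t ^ (m - 2)], the two Hardy
    weights. *)
Definition ssol (t : R) : R := t `^ a * expR (- (b * beta / m) * t `^ m).
Definition ssol1 (t : R) : R := ssol t * ((a - b * beta * t `^ m) / t).
Definition ssol_potential (t : R) : R :=
  (a - a ^+ 2 + ((m - 1 + 2 * a) * b) * (beta * t `^ m)
   - b ^+ 2 * (beta * t `^ m) ^+ 2) / t ^+ 2.

Lemma ssol_gt0 t : 0 < t -> 0 < ssol t.
Proof. by move=> t0; rewrite mulr_gt0 ?powR_gt0 ?expR_gt0. Qed.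

Let d_powR (c t : R) : 0 < t ->
  is_derive t 1 (fun s : R => s `^ c) (c * t `^ c / t).
Proof.
move=> t0; apply: is_derive_eq (is_derive1_powR c t0) _.
rewrite (@powRB _ t c 1) ?(gt_eqF t0) ?implybT//.
by rewrite powRr1 ?(ltW t0)// mulrA.
Qed.

Lemma is_derive_ssol (t : R) : 0 < t -> is_derive t 1 ssol (ssol1 t).
Proof.
move=> t0; have dm := is_derive1Z (- (b * beta / m)) (d_powR m t0).
have de := @is_derive1_comp _ expR (fun s => - (b * beta / m) * s `^ m) t _ _ (is_derive_expR _) dm.
apply: is_derive_eq (is_derive1M (d_powR a t0) de) _.
rewrite /ssol1 /ssol /=; set w := expR _; set v := t `^ m; set u := t `^ a.
by clearbody w v u; field; rewrite !gt_eqF.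
Qed.

Lemma is_derive_ssol1 (t : R) : 0 < t ->
  is_derive t 1 ssol1 (- (ssol t * ssol_potential t)).
Proof.
move=> t0.
have dv : is_derive t 1 (fun s : R => s^-1) (- t ^- 2).
  apply: is_derive_eq (is_deriveV _ _) _; first by rewrite gt_eqF.
  by rewrite /GRing.scale/= mulr1.
have dn := is_derive1B (is_derive_cst a t 1) (is_derive1Z (b * beta) (d_powR m t0)).
apply: is_derive_eq (is_derive1M (is_derive_ssol t0) (is_derive1M dn dv)) _.
rewrite /ssol1 /ssol_potential; move: (ssol t) (t `^ m) => u v.
by rewrite /cst /=; field; rewrite gt_eqF.
Qed.

Lemma continuous_ssol_potential (t : R) : 0 < t ->
  {for t, continuous (fun s => ssol s * ssol_potential s)}.
Proof.
move=> t0.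
have dt := is_derive1Z beta (d_powR m t0).
have dtt := is_derive1M dt dt.
have d1 := is_derive1B (is_derive1D (is_derive_cst (a - a ^+ 2) t 1)
   (is_derive1Z ((m - 1 + 2 * a) * b) dt)) (is_derive1Z (b ^+ 2) dtt).
have dv : is_derive t 1 (fun s : R => s^-1) (- t ^- 2).
  apply: is_derive_eq (is_deriveV _ _) _; first by rewrite gt_eqF.
  by rewrite /GRing.scale/= mulr1.
have d2 := is_derive1M (is_derive_ssol t0) (is_derive1M d1 (is_derive1M dv dv)).
have := is_derive1_continuous d2; congr (continuous_at _ _).
apply/funext => s; rewrite /ssol_potential /cst /=; congr (_ * (_ * _)).
by rewrite -invfM -expr2.
Qed.

Hypotheses (b0 : 0 <= b) (ba : b <= a) (beta0 : 0 <= beta).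

Lemma ssol1_ge0 t : 0 < t -> beta * t `^ m <= 1 -> 0 <= ssol1 t.
Proof.
move=> t0 bt; rewrite mulr_ge0 ?(ltW (ssol_gt0 t0))// divr_ge0 ?(ltW t0)//.
rewrite -mulrA subr_ge0 (le_trans _ ba)//.
by rewrite -[leRHS]mulr1 ler_wpM2l.
Qed.

Lemma ssol_potential_ge (alpha kappa t : R) : 0 < t -> beta * t `^ m <= 1 ->
  alpha <= a - a ^+ 2 -> kappa <= (m - 1 + 2 * a) * b - b ^+ 2 ->
  (alpha + kappa * (beta * t `^ m)) / t ^+ 2 <= ssol_potential t.
Proof.
move=> t0 bt al ka; rewrite ler_pM2r ?invr_gt0 ?exprn_gt0//.
have : 0 <= beta * t `^ m by rewrite mulr_ge0 ?powR_ge0.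
move: (beta * _) bt => v v1 v0.
have h1 : 0 <= ((m - 1 + 2 * a) * b - b ^+ 2 - kappa) * v.
  by rewrite mulr_ge0// subr_ge0.
have h2 : 0 <= b ^+ 2 * (v * (1 - v)).
  by rewrite mulr_ge0 ?sqr_ge0// mulr_ge0// subr_ge0.
by move: al h1 h2; lra.
Qed.

End supersolution.
End one_dimensional.

(** * The discrete Hardy inequality *)

(** Ground-state form of the discrete gradient: the difference of the two sides
    is [(a * sqrt (p' / p) - b * sqrt (p / p')) ^ 2] when both weights are
    positive. *)
Lemma discrete_ground_state (R : realType) (a b p p' : R) :
  0 <= p -> 0 <= p' -> (a != 0 -> 0 < p) -> (b != 0 -> 0 < p') ->
  a ^+ 2 + b ^+ 2 <= (b - a) ^+ 2 + a ^+ 2 * (p' / p) + b ^+ 2 * (p / p').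
Proof.
move=> p0 p'0 ap bp; have [->|a0] := eqVneq a 0.
  by rewrite !expr0n/= mul0r subr0 addr0 add0r lerDl mulr_ge0 ?sqr_ge0// divr_ge0.
have [->|b0] := eqVneq b 0.
  rewrite !expr0n/= mul0r sub0r sqrrN !addr0 lerDl mulr_ge0 ?sqr_ge0// divr_ge0//.
have {}p0 := ap a0; have {}p'0 := bp b0.
rewrite -subr_ge0 (_ : _ - _ = (a * p' - b * p) ^+ 2 / (p * p')).
  by rewrite divr_ge0 ?sqr_ge0// mulr_ge0// ltW.
by field; rewrite !gt_eqF.
Qed.

Section hardy.
Context {R : realType} {n : nat}.
Local Notation mu := (lebesgue_rV R n).
Local Notation e_ i := (delta_mx ord0 i : 'rV[R]_n).

Section discrete_hardy.
Variables (G psi : 'rV[R]_n -> R) (v : 'rV[R]_n).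
Hypothesis mG : measurable_fun setT G.
Hypothesis mpsi : measurable_fun setT psi.
Hypothesis psi_ge0 : forall x, 0 <= psi x.
Hypothesis psi_gt0 : forall x, G x != 0 -> 0 < psi x.
Hypothesis G_L2 : (\int[mu]_x (G x ^+ 2)%:E < +oo)%E.
Hypothesis psi_concave : forall x, G x != 0 ->
  0 <= 2 * psi x - psi (x + v) - psi (x - v).

Let mGv (w : 'rV[R]_n) : measurable_fun setT (fun x : 'rV[R]_n => G (x + w)).
Proof. by apply: (measurableT_comp mG); exact: measurable_translate. Qed.

Let mpsiv (w : 'rV[R]_n) : measurable_fun setT (fun x : 'rV[R]_n => psi (x + w)).
Proof. by apply: (measurableT_comp mpsi); exact: measurable_translate. Qed.

Let mpsiV (w : 'rV[R]_n) : measurable_fun setT (fun x : 'rV[R]_n => (psi (x + w))^-1).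
Proof.
rewrite (_ : (fun x => _) = (fun x : 'rV[R]_n => psi (x + w) `^ (-1))).
  exact: (measurableT_comp (measurable_powR (-1)) (mpsiv w)).
by apply/funext => x; rewrite powR_inv1.
Qed.

(** The pointwise identity behind the ground-state representation is integrated;
    translation invariance recombines the terms at [x] and at [x + v] into the
    second difference of [psi]. All the terms are nonnegative, and [G_L2] makes them
    finite, so that they can be subtracted. *)
Lemma discrete_hardy :
  (\int[mu]_x (G x ^+ 2 * ((2 * psi x - psi (x + v) - psi (x - v)) / psi x))%:E
   <= \int[mu]_x ((G (x + v) - G x) ^+ 2)%:E)%E.
Proof.
pose A x := G x ^+ 2.
pose P (w x : 'rV[R]_n) := A x * (psi (x + w) / psi x).
pose H x := G x ^+ 2 * ((2 * psi x - psi (x + v) - psi (x - v)) / psi x).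
pose E x := (G (x + v) - G x) ^+ 2.
have mG0 : measurable_fun setT (fun x : 'rV[R]_n => (psi x)^-1).
  rewrite (_ : (fun x => _) = (fun x : 'rV[R]_n => (psi (x + 0))^-1)).
    exact: mpsiV.
  by apply/funext => x; rewrite addr0.
have mA : measurable_fun setT A by exact: measurable_funX.
have mP w : measurable_fun setT (P w).
  by apply: measurable_funM => //; exact: measurable_funM.
have mH : measurable_fun setT H.
  apply: measurable_funM; first exact: measurable_funX.
  apply: measurable_funM => //; apply: measurable_funB => //.
  by apply: measurable_funB => //; exact: measurable_funM.
have mE : measurable_fun setT E by apply: measurable_funX; exact: measurable_funB.
have A0 x : 0 <= A x by rewrite sqr_ge0.
have P0 w x : 0 <= P w x by rewrite mulr_ge0// divr_ge0.
have H0 x : 0 <= H x.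
  have [Gx|Gx] := eqVneq (G x) 0; first by rewrite /H Gx expr0n/= mul0r.
  by rewrite mulr_ge0 ?sqr_ge0// divr_ge0// psi_concave.
have E0 x : 0 <= E x by rewrite sqr_ge0.
pose I (f : 'rV[R]_n -> R) := (\int[mu]_x (f x)%:E)%E.
have ID (f h : 'rV[R]_n -> R) : measurable_fun setT f -> measurable_fun setT h ->
    (forall x, 0 <= f x) -> (forall x, 0 <= h x) ->
    (I (fun x => (f x + h x)%R) = I f + I h)%E.
  move=> mf mh f0 h0; rewrite /I; under eq_integral do rewrite EFinD.
  rewrite ge0_integralD//; try (by move=> x _; rewrite lee_fin);
    exact/measurable_EFinP.
have IT (f : 'rV[R]_n -> R) : measurable_fun setT f -> (forall x, 0 <= f x) ->
    I (fun x => f (x + v)) = I f.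
  move=> mf f0; rewrite /I (@ge0_integral_translate _ _ v (fun x => (f x)%:E))//.
  exact/measurable_EFinP.
have I0 (f : _ -> R) : (forall x, 0 <= f x) -> (0 <= I f)%E.
  by move=> f0; apply: integral_ge0 => x _; rewrite lee_fin.
have split2 : (I H + (I (P v) + I (P (- v)%R)) = I A + I A)%E.
  have mPP : measurable_fun setT (fun x => P v x + P (- v) x).
    exact: measurable_funD.
  have PP0 x : 0 <= P v x + P (- v) x by rewrite addr_ge0.
  rewrite -(ID _ _ (mP v) (mP _) (P0 v) (P0 _)) -(ID _ _ mH mPP H0 PP0).
  rewrite -(ID _ _ mA mA A0 A0); congr I; apply/funext => x; rewrite /H /P -/(A x).
  have [Gx|Gx] := eqVneq (G x) 0; first by rewrite /A Gx expr0n/=; ring.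
  by field; rewrite gt_eqF// psi_gt0.
have AA : (I A + I A <= I E + (I (P v) + I (P (- v)%R)))%E.
  have mAv : measurable_fun setT (fun x : 'rV[R]_n => A (x + v)).
    by apply: measurableT_comp mA (measurable_translate v).
  have mPv : measurable_fun setT (fun x : 'rV[R]_n => P (- v) (x + v)).
    by apply: measurableT_comp (mP _) (measurable_translate v).
  have mEP : measurable_fun setT (fun x => E x + P v x) by exact: measurable_funD.
  have EP0 x : 0 <= E x + P v x by rewrite addr_ge0.
  rewrite -{2}(IT A mA A0) -(IT (P (- v)) (mP _) (P0 _)) addeA.
  rewrite -(ID _ _ mA mAv A0 (fun x => A0 (x + v))).
  rewrite -(ID _ _ mE (mP v) E0 (P0 v)).
  rewrite -(ID _ _ mEP mPv EP0 (fun x => P0 (- v) (x + v))).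
  apply: ge0_le_integral => //=.
  - by move=> x _; rewrite lee_fin addr_ge0.
  - by apply/measurable_EFinP; exact: measurable_funD.
  - by apply/measurable_EFinP; exact: measurable_funD.
  move=> x _; rewrite lee_fin /E /P /A addrK.
  exact: discrete_ground_state (psi_ge0 _) (psi_ge0 _) (@psi_gt0 _) (@psi_gt0 _).
have fA : I A \is a fin_num by rewrite ge0_fin_numE ?I0.
have fP : (I (P v) + I (P (- v)%R))%E \is a fin_num.
  rewrite ge0_fin_numE; last by rewrite adde_ge0// I0.
  apply: (@le_lt_trans _ _ (I A + I A)%E).
    by rewrite -split2 leeDr// I0.
  by rewrite lte_add_pinfty.
by rewrite -/(I H) -/(I E) -(leeD2rE _ _ fP) split2.
Qed.
End discrete_hardy.
End hardy.

(** * Extension by zero of a compactly supported function *)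

Lemma near_eq_continuous_at (T U : topologicalType) (f h : T -> U) (x : T) :
  (\forall y \near x, f y = h y) -> {for x, continuous f} ->
  {for x, continuous h}.
Proof.
move=> fh cf; rewrite /prop_for /continuous_at -(nbhs_singleton fh).
by apply: cvg_trans cf; apply: near_eq_cvg; exact: fh.
Qed.

Section zero_extension.
Context {R : realType} {n : nat}.
Local Notation e_ i := (delta_mx ord0 i : 'rV[R]_n).
Variables (Omega : set 'rV[R]_n) (g : 'rV[R]_n -> R).
Hypothesis Omega_open : open Omega.

Definition zero_ext (f : 'rV[R]_n -> R) (x : 'rV[R]_n) : R :=
  if x \in Omega then f x else 0.

Lemma zero_ext_in f x : Omega x -> zero_ext f x = f x.
Proof. by move=> Ox; rewrite /zero_ext mem_set. Qed.

Lemma zero_ext_notin f x : ~ Omega x -> zero_ext f x = 0.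
Proof. by move=> Ox; rewrite /zero_ext memNset. Qed.

Hypothesis g_C1 : C1_compact_support Omega g.

Let supp := closure [set x | Omega x /\ g x != 0].
Let G := zero_ext g.

Let csupp : compact supp. Proof. by case: g_C1. Qed.
Let supp_sub : supp `<=` Omega. Proof. by case: g_C1. Qed.

Lemma zero_ext_supp x : G x != 0 -> supp x.
Proof.
rewrite /G /zero_ext; case: ifPn => [/set_mem Ox gx|]; last by rewrite eqxx.
by apply: subset_closure; split.
Qed.

Lemma near_zero_ext x : Omega x -> \forall y \near x, g y = G y.
Proof.
move=> Ox; have : nbhs x Omega by exact: open_nbhs_nbhs.
by apply: filterS => y Oy; rewrite /G zero_ext_in.
Qed.

Lemma near_zero_ext0 x : ~ supp x -> \forall y \near x, 0 = G y.
Proof.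
move=> Kx; have : nbhs x (~` supp).
  by apply: open_nbhs_nbhs; split => //; apply: closed_openC; exact: closed_closure.
by apply: filterS => y Ky; apply/esym/eqP; apply: contra_notT Ky; exact: zero_ext_supp.
Qed.

Lemma is_derive_zero_ext x i :
  is_derive x (e_ i) G (zero_ext (fun y => 'D_(e_ i) g y) x).
Proof.
have [Ox|Ox] := pselect (Omega x).
  rewrite zero_ext_in//; apply: near_eq_is_derive (near_zero_ext Ox) _.
  by apply: DeriveDef => //; apply: diff_derivable; case: g_C1 => + _ _ _; apply.
rewrite zero_ext_notin//.
have Kx : ~ supp x by move=> /supp_sub.
exact: near_eq_is_derive (near_zero_ext0 Kx) (is_derive_cst _ _ _).
Qed.

Lemma partial_zero_ext0 x i : ~ supp x -> 'D_(e_ i) G x = 0.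
Proof.
move=> Kx.
by have [_ ->] := near_eq_is_derive (near_zero_ext0 Kx) (is_derive_cst (0 : R) x (e_ i)).
Qed.

Lemma continuous_zero_ext : continuous G.
Proof.
move=> x; have [Ox|Ox] := pselect (Omega x).
  have dg : differentiable g x by case: g_C1 => + _ _ _; apply.
  exact: near_eq_continuous_at (near_zero_ext Ox) (differentiable_continuous dg).
have Kx : ~ supp x by move=> /supp_sub.
exact: near_eq_continuous_at (near_zero_ext0 Kx) (@cst_continuous _ _ 0 x).
Qed.

Lemma continuous_partial_zero_ext i : continuous (fun x => 'D_(e_ i) G x).
Proof.
move=> x; have [Ox|Ox] := pselect (Omega x).
  have cg : {for x, continuous (gradient g)} by case: g_C1 => _ + _ _; apply.
  have nE : \forall y \near x, gradient g y ord0 i = 'D_(e_ i) G y.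
    have : nbhs x Omega by exact: open_nbhs_nbhs.
    apply: filterS => y Oy; rewrite mxE.
    by have [_ ->] := is_derive_zero_ext y i; rewrite zero_ext_in.
  have cgi : {for x, continuous (fun y => gradient g y ord0 i)}.
    exact: (@continuous_comp _ _ _ (gradient g) (fun M : 'rV[R]_n => M ord0 i) x cg
      (@coord_continuous R 1 n ord0 i _)).
  exact: near_eq_continuous_at nE cgi.
have Kx : ~ supp x by move=> /supp_sub.
have nE : \forall y \near x, 0 = 'D_(e_ i) G y.
  have : nbhs x (~` supp).
    by apply: open_nbhs_nbhs; split => //; apply: closed_openC; exact: closed_closure.
  by apply: filterS => y Ky; rewrite partial_zero_ext0.
exact: near_eq_continuous_at nE (@cst_continuous _ _ 0 x).
Qed.

Lemma bounded_of_supp (f : 'rV[R]_n -> R) : continuous f ->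
  (forall x, ~ supp x -> f x = 0) -> exists2 L, 0 <= L & forall x, `|f x| <= L.
Proof.
move=> cf f0.
have : compact (f @` supp).
  by apply: continuous_compact => //; exact: continuous_subspaceT.
move=> /compact_bounded[M [Mr HM]]; exists (`|M| + 1); first by rewrite addr_ge0.
move=> x; have [Kx|Kx] := pselect (supp x); last by rewrite f0// normr0 addr_ge0.
apply: (HM (`|M| + 1)); first by rewrite (le_lt_trans (ler_norm _))// ltrDl.
by exists x.
Qed.

Lemma supp_cube : exists2 N, 0 <= N & supp `<=` cube N.
Proof.
have [M [Mr HM]] := compact_bounded csupp.
exists (`|M| + 1); first by rewrite addr_ge0.
move=> x Kx i; apply: le_trans (HM _ _ _ Kx) => //; last first.
  by rewrite (le_lt_trans (ler_norm _))// ltrDl.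
exact: ler_norm_coord.
Qed.

Lemma sum_sqr_partial_zero_ext x :
  \sum_i ('D_(e_ i) G x) ^+ 2 = zero_ext (fun y => enorm (gradient g y) ^+ 2) x.
Proof.
have [Ox|Ox] := pselect (Omega x).
  rewrite zero_ext_in// sqr_sqrtr ?sumr_ge0// => [|i _]; last exact: sqr_ge0.
  apply: eq_bigr => i _; rewrite mxE.
  by have [_ ->] := is_derive_zero_ext x i; rewrite zero_ext_in.
rewrite zero_ext_notin// big1// => i _.
by have [_ ->] := is_derive_zero_ext x i; rewrite zero_ext_notin// expr0n.
Qed.

End zero_extension.

(** * Limits of integrals *)

Lemma limn_einf_ge (R : realType) (u : (\bar R)^nat) (v : R) :
  (forall eps : R, 0 < eps -> \forall k \near \oo, ((v - eps)%:E <= u k)%E) ->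
  (v%:E <= limn_einf u)%E.
Proof.
move=> H; apply/lee_addgt0Pr => e e0; rewrite limn_einf_lim.
rewrite -leeBlDr//; apply: lime_ge; first exact: is_cvg_einfs.
have [N _ HN] := H _ e0; exists N => // k /= Nk.
apply: le_ereal_inf_tmp => _ [j /= kj <-].
by have := HN j (leq_trans Nk kj); rewrite EFinB.
Qed.

Lemma limn_einf_le (R : realType) (u r : (\bar R)^nat) (l : \bar R) :
  (forall k, (u k <= r k)%E) -> r @ \oo --> l -> (limn_einf u <= l)%E.
Proof.
move=> ur rl; rewrite limn_einf_lim -(cvg_lim (@ereal_hausdorff R) rl).
apply: lee_lim; [exact: is_cvg_einfs|by apply/cvg_ex; exists l|].
apply: nearW => k; apply: le_trans (ur k).
by apply: ereal_inf_lbound; exists k => /=.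
Qed.

(** Fatou's lemma for functions [h k] that are only known to be eventually above
    [V - eps] at each point. *)
Lemma fatou_lower_bound d (T : measurableType d) (R : realType)
    (mu : {measure set T -> \bar R}) (h : (T -> R)^nat) (V : T -> R)
    (r : (\bar R)^nat) (l : \bar R) :
  (forall k, measurable_fun setT (h k)) -> measurable_fun setT V ->
  (forall k x, 0 <= h k x) -> (forall x, 0 <= V x) ->
  (forall k, (\int[mu]_x (h k x)%:E <= r k)%E) -> r @ \oo --> l ->
  (forall x (eps : R), 0 < eps -> \forall k \near \oo, V x - eps <= h k x) ->
  (\int[mu]_x (V x)%:E <= l)%E.
Proof.
move=> mh mV h0 V0 hr rl Vh.
have mhE k : measurable_fun setT (fun x => (h k x)%:E) by exact/measurable_EFinP.
have F := @fatou _ _ _ mu setT measurableT (fun k x => (h k x)%:E) mhE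
  (fun k x _ => h0 k x).
apply: (le_trans _ (le_trans F (limn_einf_le hr rl))).
apply: ge0_le_integral => //.
- by move=> x _; rewrite lee_fin.
- exact/measurable_EFinP.
- rewrite /limn_einf; apply: measurableT_comp => //.
  apply: (@measurable_fun_limn_esup _ _ _ _ (fun k x => (- (h k x)%:E)%E)) => k.
  by apply: measurableT_comp.
- by move=> x _; apply: limn_einf_ge => e e0; have := Vh x _ e0.
Qed.

(** * Hardy's inequality for a supersolution of the distance *)

Lemma measurable_zero_ext (R : realType) (n : nat) (Omega : set 'rV[R]_n)
    (f : 'rV[R]_n -> R) : measurable Omega -> measurable_fun Omega f ->
  measurable_fun setT (zero_ext Omega f).
Proof.
move=> mO mf; rewrite (_ : zero_ext Omega f = f \_ Omega).
  exact/(measurable_restrictT f mO).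
by apply/funext => x; rewrite /zero_ext patchE.
Qed.

Lemma integral_zero_ext (R : realType) (n : nat) (Omega : set 'rV[R]_n)
    (f : 'rV[R]_n -> R) :
  (\int[lebesgue_rV R n]_(x in Omega) (f x)%:E =
   \int[lebesgue_rV R n]_x (zero_ext Omega f x)%:E)%E.
Proof.
rewrite integral_mkcond; apply: eq_integral => x _.
by rewrite /zero_ext patchE; case: ifP.
Qed.

Lemma ge0_le_integral_scale_sum d (T : measurableType d) (R : realType)
    (mu : {measure set T -> \bar R}) (I : Type) (s : seq I) (A B : I -> T -> R)
    (c : R) : 0 <= c ->
  (forall i, measurable_fun setT (A i)) -> (forall i, measurable_fun setT (B i)) ->
  (forall i x, 0 <= A i x) -> (forall i x, 0 <= B i x) ->
  (forall i, \int[mu]_x (A i x)%:E <= \int[mu]_x (B i x)%:E)%E ->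
  (\int[mu]_x (\sum_(i <- s) c * A i x)%:E <=
   \int[mu]_x (\sum_(i <- s) c * B i x)%:E)%E.
Proof.
move=> c0 mA mB A0 B0 AB.
have E (F : I -> T -> R) : (forall i, measurable_fun setT (F i)) ->
    (forall i x, 0 <= F i x) ->
    (\int[mu]_x (\sum_(i <- s) c * F i x)%:E =
      \sum_(i <- s) c%:E * \int[mu]_x (F i x)%:E)%E.
  move=> mF F0; under eq_integral do rewrite -sumEFin.
  rewrite ge0_integral_sum//.
  - apply: eq_bigr => i _; under eq_integral do rewrite EFinM.
    by rewrite ge0_integralZl_EFin//; [move=> x _; rewrite lee_fin|exact/measurable_EFinP].
  - by move=> i; apply/measurable_EFinP; exact: measurable_funM.
  - by move=> i x _; rewrite lee_fin mulr_ge0.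
rewrite !E//; apply: lee_sum => i _; by apply: lee_wpmul2l; rewrite ?lee_fin.
Qed.

Lemma integral_indic_cube (R : realType) (n : nat) (C N : R) :
  0 <= C -> 0 <= N ->
  (\int[lebesgue_rV R n]_x (C * \1_(cube N) x)%:E < +oo)%E.
Proof.
move=> C0 N0; have mC : measurable (@cube R n N) by exact: measurable_cube.
under eq_integral do rewrite EFinM.
rewrite ge0_integralZl_EFin//; last exact/measurable_EFinP/measurable_indic.
rewrite integral_indic// setIT lte_mul_pinfty//.
exact: lebesgue_rV_cube_fin.
Qed.

Section hardy_of_supersolution.
Context {R : realType} {n : nat}.
Local Notation mu := (lebesgue_rV R n).
Local Notation e_ i := (delta_mx ord0 i : 'rV[R]_n).
Variables (Omega : set 'rV[R]_n) (g : 'rV[R]_n -> R).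
Hypothesis Omega_open : open Omega.
Hypothesis g_C1 : C1_compact_support Omega g.

Variables (d : 'rV[R]_n -> R) (delta0 D : R).
Hypothesis d_gt0 : forall x, Omega x -> 0 < d x.
Hypothesis d_le : forall x, Omega x -> d x <= delta0.
Hypothesis delta0D : delta0 < D.
Hypothesis d_barrier : forall x, Omega x -> exists2 nu, dot nu nu = 1 &
  forall z, Omega z -> d z <= d x + dot nu (z - x).

Variables (f f1 f2 : R -> R).
Hypothesis f_gt0 : forall t : R, 0 < t < D -> 0 < f t.
Hypothesis df : forall t : R, 0 < t < D -> is_derive t 1 f (f1 t).
Hypothesis f1_ge0 : forall t : R, 0 < t < D -> 0 <= f1 t.
Hypothesis df1 : forall t : R, 0 < t < D -> is_derive t 1 f1 (- f2 t).
Hypothesis f2_ge0 : forall t : R, 0 < t < D -> 0 <= f2 t.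
Hypothesis f2_cont : forall t : R, 0 < t < D -> {for t, continuous f2}.

Lemma unit_coord_le1 (nu : 'rV[R]_n) i : dot nu nu = 1 -> `|nu ord0 i| <= 1.
Proof.
by move=> nu1; rewrite (le_trans (coord_le_enorm nu i))// enormE nu1 sqrtr1.
Qed.

(** The barriers at two points bound the increment of [d] from both sides. *)
Lemma barrier_continuous : {in Omega, continuous d}.
Proof.
move=> x /set_mem Ox; apply/(@cvgrPdist_le _ _ _ _ (nbhs_filter x)) => eps eps0.
pose eta := eps / (n%:R + 1).
have n1 : 0 < n%:R + 1 :> R by rewrite ltr_wpDl.
have eta0 : 0 < eta by rewrite divr_gt0.
have dot_le (nu w : 'rV[R]_n) : dot nu nu = 1 -> `|w| <= eta -> dot nu w <= eps.
  move=> nu1 weta; apply: (@le_trans _ _ (\sum_(i < n) eta)).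
    apply: ler_sum => i _; rewrite (le_trans (ler_norm _))// normrM.
    rewrite -[leRHS]mul1r ler_pM ?unit_coord_le1//.
    by rewrite (le_trans (ler_norm_coord _ _)).
  rewrite sumr_const card_ord -mulr_natl /eta mulrCA ger_pMr//.
  by rewrite ler_pdivrMr// mul1r lerDl.
near=> z.
have Oz : Omega z by near: z; exact: open_nbhs_nbhs.
have xz : `|x - z| <= eta.
  near: z; have : nbhs x (ball x eta) by exact: nbhsx_ballx.
  by apply: filterS => z; rewrite -ball_normE /= => /ltW.
have [nu nu1 nuz] := d_barrier Ox; have [nu' nu'1 nux] := d_barrier Oz.
rewrite ler_norml; apply/andP; split.
  rewrite lerNl opprB lerBlDl (le_trans (nuz _ Oz))// lerD2l.
  by rewrite dot_le// distrC.
by rewrite lerBlDl (le_trans (nux _ Ox))// lerD2l dot_le.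
Unshelve. all: by end_near. Qed.

Let mono_f (s t : R) : 0 < s -> s <= t -> t < D -> f s <= f t.
Proof.
move=> s0 st tD.
have dk' (r : R) : s <= r <= t -> 0 < r < D.
  by move=> /andP[t1 t2]; rewrite (lt_le_trans s0)//= (le_lt_trans t2).
have [||c] := @MVT_segment _ f f1 s t st.
- by move=> r; rewrite in_itv/= => /andP[t1 t2]; apply: df; apply: dk'; rewrite !ltW.
- apply: derivable_within_continuous => r; rewrite in_itv/= => tab.
  by have [] := df (dk' _ tab).
- rewrite in_itv/= => cab E; rewrite -subr_ge0 E mulr_ge0 ?subr_ge0//.
  by rewrite f1_ge0// dk'.
Qed.

Let psi := zero_ext Omega (fun x => f (d x)).

Let d_range x : Omega x -> 0 < d x < D.
Proof. by move=> Ox; rewrite d_gt0//= (le_lt_trans (d_le Ox)). Qed.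

Let psi_ge0 x : 0 <= psi x.
Proof.
have [Ox|Ox] := pselect (Omega x); last by rewrite /psi zero_ext_notin.
by rewrite /psi zero_ext_in// ltW// f_gt0// d_range.
Qed.

(** The second difference of [psi] in the direction [i] is bounded by the one
    of [f] along the tangent line [d x + s * nu_i], because [f] is
    nondecreasing. *)
Let second_difference_psi x (nu : 'rV[R]_n) i (s L : R) :
  Omega x -> dot nu nu = 1 ->
  (forall z, Omega z -> d z <= d x + dot nu (z - x)) ->
  0 < s -> s < d x -> d x + s < D ->
  (forall r, d x - s <= r <= d x + s -> L <= f2 r) ->
  L * (s * nu ord0 i) ^+ 2 <=
    2 * psi x - psi (x + s *: e_ i) - psi (x - s *: e_ i).
Proof.
move=> Ox nu1 nuz s0 sd sD Lf.
have nui := unit_coord_le1 i nu1.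
have hs : `|s * nu ord0 i| <= s by rewrite normrM gtr0_norm// ler_piMr// ltW.
have dot_e : dot nu (e_ i) = nu ord0 i.
  rewrite /dot (bigD1 i)//= big1 ?addr0 => [|j ji].
    by rewrite mxE !eqxx mulr1.
  by rewrite mxE eqxx/= (negbTE ji) mulr0.
have le_psi (h : R) : `|h * nu ord0 i| <= s ->
    psi (x + h *: e_ i) <= f (d x + h * nu ord0 i).
  rewrite ler_norml => /andP[h1 h2].
  have [Oz|Oz] := pselect (Omega (x + h *: e_ i)); last first.
    by rewrite /psi zero_ext_notin// ltW// f_gt0//; apply/andP; split; lra.
  rewrite /psi zero_ext_in//; apply: mono_f; first exact: d_gt0.
    by rewrite (le_trans (nuz _ Oz))// addrAC subrr add0r dotZr dot_e.
  by lra.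
have p1 := le_psi s hs.
have p2 : psi (x - s *: e_ i) <= f (d x - s * nu ord0 i).
  by rewrite -scaleNr -mulNr le_psi// mulNr normrN.
have p0 : psi x = f (d x) by rewrite /psi zero_ext_in.
have [h1 h2] : - s <= - `|s * nu ord0 i| /\ `|s * nu ord0 i| <= s by lra.
have := @second_difference_lb _ f f1 f2 D df df1 L (d x) (s * nu ord0 i).
move=> /(_ _ _ _)/le_trans; apply.
- by lra.
- by lra.
- by move=> r /andP[r1 r2]; apply: Lf; apply/andP; split; lra.
- by lra.
Qed.

Let supp := closure [set x | Omega x /\ g x != 0].

Let supp_d_lb : exists2 d0, 0 < d0 & forall x, supp x -> d0 <= d x.
Proof.
have [cK KO] : compact supp /\ supp `<=` Omega by case: g_C1.
have [K0|/set0P K0] := eqVneq supp set0.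
  by exists 1 => // x; rewrite K0.
have cd : {within supp, continuous d}.
  apply: (continuous_subspaceW KO).
  by rewrite continuous_open_subspace//; exact: barrier_continuous.
have [c /set_mem Kc cmin] := @compact_EVT_min _ R d supp K0 cK cd.
exists (d c); first by apply: d_gt0; exact: KO.
by move=> x Kx; apply: cmin; exact: mem_set.
Qed.

Let G := zero_ext Omega g.

Let G_supp x : G x != 0 -> supp x.
Proof. exact: zero_ext_supp. Qed.

Let supp_Omega x : supp x -> Omega x.
Proof. by case: g_C1 => _ _ _; apply. Qed.

Let mG : measurable_fun setT G.
Proof.
apply: open_continuous_measurable_rV; first exact: openT.
by move=> x _; exact: continuous_zero_ext.
Qed.

Let mOmega : measurable Omega.
Proof. exact: open_measurable_rV. Qed.

Let comp_d (k : R -> R) : (forall t, 0 < t < D -> {for t, continuous k}) ->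
  measurable_fun Omega (fun x => k (d x)).
Proof.
move=> kc; apply: open_continuous_measurable_rV => // x Ox.
apply: continuous_comp; first exact: barrier_continuous.
by apply: kc; apply: d_range; exact: set_mem.
Qed.

Let mpsi : measurable_fun setT psi.
Proof.
apply: measurable_zero_ext => //; apply: comp_d => t tD.
exact: (is_derive1_continuous (df tD)).
Qed.

Let is_derive_line x i (t : R) :
  is_derive t 1 (fun s : R => G (x + s *: e_ i)) ('D_(e_ i) G (x + t *: e_ i)).
Proof.
have [dG _] := is_derive_zero_ext Omega_open g_C1 (x + t *: e_ i) i.
have E : (fun h : R => h^-1 *: (((fun s : R => G (x + s *: e_ i)) \o shift t) (h *: 1)
    - G (x + t *: e_ i))) =
  (fun h : R => h^-1 *: ((G \o shift (x + t *: e_ i)) (h *: e_ i) - G (x + t *: e_ i))).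
  apply/funext => h /=; congr (_ *: (G _ - _)).
  by rewrite [h *: 1]mulr1 scalerDl addrCA addrA.
by split; rewrite /derivable /derive E.
Qed.

Let partial_bound : exists2 L : R, 0 <= L & forall i x, `|'D_(e_ i) G x| <= L.
Proof.
have /choice[L HL] i : exists L : R, 0 <= L /\ forall x, `|'D_(e_ i) G x| <= L.
  have [L L0 HL] := bounded_of_supp g_C1 (continuous_partial_zero_ext Omega_open g_C1 (i := i))
    (fun x => @partial_zero_ext0 _ _ _ g x i).
  by exists L.
exists (\sum_i L i); first by apply: sumr_ge0 => i _; case: (HL i).
move=> i x; rewrite (bigD1 i)//= (le_trans ((HL i).2 x))// lerDl.
by apply: sumr_ge0 => j _; case: (HL j).
Qed.

Let quotient_bound (L : R) : (forall i x, `|'D_(e_ i) G x| <= L) ->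
  forall i x (s : R), 0 < s -> `|(G (x + s *: e_ i) - G x) / s| <= L.
Proof.
move=> HL i x s s0.
have [|c _] := @MVT _ (fun t => G (x + t *: e_ i)) _ 0 s s0
    (fun t _ => is_derive_line x i t).
  apply: derivable_within_continuous => t _.
  by have [] := is_derive_line x i t.
rewrite scale0r addr0 subr0 => ->.
by rewrite mulfK ?gt_eqF// HL.
Qed.

Let G_notin_supp x : ~ supp x -> G x = 0.
Proof. by move=> Kx; apply/eqP; apply: contra_notT Kx; exact: G_supp. Qed.

Let G_L2 : (\int[mu]_x (G x ^+ 2)%:E < +oo)%E.
Proof.
have [N N0 HN] := supp_cube g_C1.
have [B B0 HB] := bounded_of_supp g_C1 (continuous_zero_ext Omega_open g_C1)
  (@G_notin_supp).
apply: le_lt_trans (integral_indic_cube n (sqr_ge0 B) N0).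
apply: ge0_le_integral => //=.
- by move=> x _; rewrite lee_fin sqr_ge0.
- by apply/measurable_EFinP; exact: measurable_funX.
- apply/measurable_EFinP; apply: measurable_funM => //.
  by apply: measurable_indic; exact: measurable_cube.
move=> x _; rewrite lee_fin indicE; have [Kx|Kx] := pselect (supp x).
  rewrite mem_set ?mulr1; last exact: HN.
  by rewrite -[leLHS]ger0_norm ?sqr_ge0// normrX lerXn2r ?nnegrE ?HB.
by rewrite G_notin_supp// expr0n mulr_ge0 ?sqr_ge0.
Qed.

(** Dominated convergence: by the mean value theorem the difference quotients are
    bounded by a bound for the partial derivatives, and for steps at most [1]
    they vanish outside a fixed cube. *)
Let cvg_quotients (s : R^nat) : (forall k, 0 < s k <= 1) -> s @ \oo --> 0 ->
  (fun k => \int[mu]_x (\sum_i (s k ^- 2) * (G (x + s k *: e_ i) - G x) ^+ 2)%:E)%E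
    @ \oo --> (\int[mu]_x (\sum_i ('D_(e_ i) G x) ^+ 2)%:E)%E.
Proof.
move=> s01 s_cvg; have [N N0 HN] := supp_cube g_C1.
have [L L0 HL] := partial_bound.
have N10 : 0 <= N + 1 by rewrite addr_ge0.
pose C : R := \sum_(i < n) L ^+ 2.
have C0 : 0 <= C by apply: sumr_ge0 => i _; exact: sqr_ge0.
pose dom (x : 'rV[R]_n) := (C * \1_(cube (N + 1)) x)%:E.
have mquot k i : measurable_fun setT (fun x : 'rV[R]_n =>
    (s k ^- 2) * (G (x + s k *: e_ i) - G x) ^+ 2).
  apply: measurable_funM => //; apply: measurable_funX; apply: measurable_funB => //.
  exact: (measurableT_comp mG (measurable_translate _)).
have mpart i : measurable_fun setT (fun x => ('D_(e_ i) G x) ^+ 2).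
  apply: measurable_funX; apply: open_continuous_measurable_rV; first exact: openT.
  by move=> x _; exact: continuous_partial_zero_ext.
have mdom : measurable_fun setT dom.
  apply/measurable_EFinP; apply: measurable_funM => //.
  by apply: measurable_indic; exact: measurable_cube.
have idom : mu.-integrable setT dom.
  apply/integrableP; split => //.
  apply: le_lt_trans (integral_indic_cube n C0 N10).
  by under eq_integral do rewrite gee0_abs ?lee_fin ?mulr_ge0//.
have s_dnbhs : s @ \oo --> 0^'.
  move=> A /= A0; have [N' _ HN'] := s_cvg _ A0.
  by exists N' => // k /= kN; apply: HN' => //; rewrite gt_eqF//; case/andP: (s01 k).
have cquot i x : (fun k => (G (x + s k *: e_ i) - G x) / s k) @ \oo --> 'D_(e_ i) G x.
  have [dG _] := is_derive_zero_ext Omega_open g_C1 x i.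
  rewrite (_ : (fun k => _) =
      (fun h : R => h^-1 *: ((G \o shift x) (h *: e_ i) - G x)) \o s).
    exact: (@cvg_comp _ _ _ s _ _ _ _ s_dnbhs dG).
  by apply/funext => k /=; rewrite [_ *: _ + x]addrC [RHS]mulrC.
have quotE k i x : (s k ^- 2) * (G (x + s k *: e_ i) - G x) ^+ 2 =
    (G (x + s k *: e_ i) - G x) / s k * ((G (x + s k *: e_ i) - G x) / s k).
  by rewrite -expr2 exprMn exprVn mulrC.
have [|||||_ _] := @dominated_convergence _ _ _ mu setT measurableT
  (fun k x => (\sum_i (s k ^- 2) * (G (x + s k *: e_ i) - G x) ^+ 2)%:E)
  (fun x => (\sum_i ('D_(e_ i) G x) ^+ 2)%:E) dom => //.
- by move=> k; apply/measurable_EFinP; apply: measurable_sum.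
- by apply/measurable_EFinP; apply: measurable_sum.
- apply: aeW => x _; apply: cvg_EFin; first exact: nearW.
  apply: cvg_big; first exact: add_continuous.
  move=> i _; rewrite expr2 [X in X @ _ --> _](_ : _ =
      (fun k => (G (x + s k *: e_ i) - G x) / s k * ((G (x + s k *: e_ i) - G x) / s k))).
    by apply: cvgM; exact: cquot.
  by apply/funext => k; exact: quotE.
apply: aeW => x k _; rewrite /dom gee0_abs; last first.
  by rewrite lee_fin sumr_ge0// => i _; rewrite quotE -expr2 sqr_ge0.
rewrite lee_fin /C mulr_suml; apply: ler_sum => i _.
have /andP[sk0 sk1] := s01 k.
rewrite indicE; case: (boolP (x \in _)) => [_|/negP xN].
  rewrite quotE -expr2 mulr1 -[leLHS]ger0_norm ?sqr_ge0// normrX.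
  by rewrite lerXn2r ?nnegrE// (quotient_bound HL).
have xNs (y : 'rV[R]_n) : (forall j, `|y ord0 j - x ord0 j| <= 1) -> G y = 0.
  move=> yx; apply: G_notin_supp => Ky; apply: xN; apply/mem_set => j.
  rewrite -[x ord0 j](subKr (y ord0 j)) (le_trans (ler_normB _ _))//.
  by rewrite lerD//; exact: (HN _ Ky j).
rewrite !xNs ?subrr ?expr0n ?mulr0// => j.
  by rewrite subrr normr0.
rewrite !mxE [x _ _ + _]addrC addrK eqxx/= normrM (gtr0_norm sk0).
by case: eqP => _; rewrite ?normr1 ?normr0 ?mulr1 ?mulr0.
Qed.

(** The discrete inequality with [psi = f (d x)], in each coordinate direction
    and with steps [s k] tending to [0], divided by [s k ^ 2]. At a point [x] the
    sum of the second differences of [psi] is at least [s k ^ 2] times a number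
    close to [f2 (d x)], because the direction of the barrier is a unit
    vector. Fatou's lemma on the left and dominated convergence on the right
    give the limit. *)
Lemma hardy_of_supersolution :
  (\int[mu]_(x in Omega) (g x ^+ 2 * (f2 (d x) / f (d x)))%:E <=
   \int[mu]_(x in Omega) (enorm (gradient g x) ^+ 2)%:E)%E.
Proof.
have [d0 d00 Hd0] := supp_d_lb.
(* steps below [d0] and [D - delta0] keep the tangent line inside [(0, D)] *)
pose s0 := Num.min (Num.min d0 (D - delta0)) 1 / 2.
have m0 : 0 < Num.min (Num.min d0 (D - delta0)) 1 by rewrite !lt_min d00 subr_gt0 delta0D ltr01.
have s00 : 0 < s0 by rewrite divr_gt0.
have s0lt : s0 < Num.min (Num.min d0 (D - delta0)) 1.
  by rewrite /s0 ltr_pdivrMr// ltr_pMr// ltr1n.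
move: s0lt; rewrite !lt_min => /andP[/andP[s0d s0D] s01].
pose s (k : nat) := s0 * harmonic k.
have s_gt0 k : 0 < s k by rewrite mulr_gt0// invr_gt0.
have s_le k : s k <= s0 by rewrite /s ger_pMr// invf_le1// ler1n.
have s_cvg : s @ \oo --> 0.
  by rewrite -(mulr0 s0); apply: cvgM; [exact: cvg_cst|exact: cvg_harmonic].
have s1 k : 0 < s k <= 1 by rewrite s_gt0 (le_trans (s_le k))// ltW.
pose A k i (x : 'rV[R]_n) := G x ^+ 2 *
  ((2 * psi x - psi (x + s k *: e_ i) - psi (x - s k *: e_ i)) / psi x).
pose V := zero_ext Omega (fun x => g x ^+ 2 * (f2 (d x) / f (d x))).
have psi_gt0 x : G x != 0 -> 0 < psi x.
  by move=> /G_supp/supp_Omega Ox; rewrite /psi zero_ext_in// f_gt0// d_range.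
have sec k i x (nu : 'rV[R]_n) L : supp x -> dot nu nu = 1 ->
    (forall z, Omega z -> d z <= d x + dot nu (z - x)) ->
    (forall r, d x - s k <= r <= d x + s k -> L <= f2 r) ->
    L * (s k * nu ord0 i) ^+ 2 <=
    2 * psi x - psi (x + s k *: e_ i) - psi (x - s k *: e_ i).
  move=> Kx nu1 nuz Lf; have Ox := supp_Omega Kx.
  apply: second_difference_psi => //.
    by rewrite (le_lt_trans (s_le k))// (lt_le_trans s0d)// Hd0.
  have := d_le Ox; have := s_le k; lra.
have conc k i x : G x != 0 ->
    0 <= 2 * psi x - psi (x + s k *: e_ i) - psi (x - s k *: e_ i).
  move=> /G_supp Kx; have Ox := supp_Omega Kx.
  have [nu nu1 nuz] := d_barrier Ox.
  have := @sec k i x nu 0 Kx nu1 nuz; rewrite mul0r; apply => r /andP[r1 r2].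
  have := d_le Ox; have := s_le k; have := Hd0 _ Kx => h1 h2 h3.
  by apply: f2_ge0; apply/andP; split; lra.
have A0 k i x : 0 <= A k i x.
  have [Gx|Gx] := eqVneq (G x) 0; first by rewrite /A Gx expr0n mul0r.
  by rewrite mulr_ge0 ?sqr_ge0// divr_ge0// conc.
have mA k i : measurable_fun setT (A k i).
  apply: measurable_funM; first exact: measurable_funX.
  have mpv (w : 'rV[R]_n) : measurable_fun setT (fun x : 'rV[R]_n => psi (x + w)).
    exact: (measurableT_comp mpsi (measurable_translate w)).
  apply: measurable_funM; last first.
    rewrite (_ : (fun x => _) = (fun x => psi x `^ (-1))).
      exact: (measurableT_comp (measurable_powR (-1)) mpsi).
    by apply/funext => x; rewrite powR_inv1.
  by apply: measurable_funB => //; apply: measurable_funB => //; exact: measurable_funM.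
have mB k i : measurable_fun setT (fun x : 'rV[R]_n => (G (x + s k *: e_ i) - G x) ^+ 2).
  apply: measurable_funX; apply: measurable_funB => //.
  exact: (measurableT_comp mG (measurable_translate _)).
have mV : measurable_fun setT V.
  apply: measurable_zero_ext => //; apply: measurable_funM.
    apply: measurable_funX; apply: open_continuous_measurable_rV => //.
    move=> x /set_mem Ox; apply: differentiable_continuous.
    by case: g_C1 => + _ _ _; apply.
  apply: (comp_d (k := fun t => f2 t / f t)) => t tD.
  apply: cvgM; first exact: f2_cont.
  apply: cvgV; first by rewrite gt_eqF// f_gt0.
  exact: (is_derive1_continuous (df tD)).
have V0 x : 0 <= V x.
  have [Ox|Ox] := pselect (Omega x); last by rewrite /V zero_ext_notin.
  rewrite /V zero_ext_in// mulr_ge0 ?sqr_ge0// divr_ge0 ?f2_ge0 ?d_range//.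
  by rewrite ltW// f_gt0 ?d_range.
rewrite [leLHS]integral_zero_ext [leRHS]integral_zero_ext -/V.
under [leRHS]eq_integral do rewrite -(sum_sqr_partial_zero_ext Omega_open g_C1).
apply: (@fatou_lower_bound _ _ _ mu
  (fun k x => \sum_i (s k ^- 2) * A k i x) V _ _ _ _ _ _ _ (cvg_quotients s1 s_cvg)) => //.
- by move=> k; apply: measurable_sum => i; exact: measurable_funM.
- by move=> k x; apply: sumr_ge0 => i _; rewrite mulr_ge0// invr_ge0 sqr_ge0.
- move=> k; apply: ge0_le_integral_scale_sum => //.
  + by rewrite invr_ge0 sqr_ge0.
  + by move=> i x; exact: sqr_ge0.
  + move=> i; apply: discrete_hardy => //; exact: conc.
move=> x eps eps0.
have [Gx|Gx] := eqVneq (G x) 0.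
  apply: nearW => k; rewrite (@le_trans _ _ 0)//; last first.
    by apply: sumr_ge0 => i _; rewrite mulr_ge0// invr_ge0 sqr_ge0.
  have [Ox|Ox] := pselect (Omega x); last by rewrite /V zero_ext_notin// sub0r oppr_le0 ltW.
  rewrite /V zero_ext_in// -(zero_ext_in g Ox) -/G Gx expr0n mul0r sub0r oppr_le0.
  exact: ltW.
have Kx := G_supp Gx; have Ox := supp_Omega Kx.
have [nu nu1 nuz] := d_barrier Ox.
have psiE : psi x = f (d x) by rewrite /psi zero_ext_in.
have fd0 : 0 < f (d x) by rewrite -psiE psi_gt0.
have VE : V x = G x ^+ 2 * (f2 (d x) / f (d x)) by rewrite /V /G !zero_ext_in.
(* the error [G x ^ 2 * eta / f (d x)] stays below [eps] *)
pose eta := eps * f (d x) / (G x ^+ 2 + 1).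
have G1 : 0 < G x ^+ 2 + 1 by rewrite ltr_wpDl ?sqr_ge0.
have eta0 : 0 < eta by rewrite divr_gt0// mulr_gt0.
have /cvgrPdist_le/(_ _ eta0) := f2_cont (d_range Ox).
move=> /nbhs_ballP[rho /= rho0 Hrho].
have [N' _ HN'] : \forall k \near \oo, s k < rho.
  have /cvgrPdist_lt/(_ _ rho0) := s_cvg.
  by apply: filterS => k; rewrite sub0r normrN gtr0_norm.
exists N' => // k /= kN'.
have srho := HN' _ kN'.
have Lf r : d x - s k <= r <= d x + s k -> f2 (d x) - eta <= f2 r.
  move=> /andP[r1 r2]; have /ler_normlP[_] : `|f2 (d x) - f2 r| <= eta.
    by apply: Hrho; rewrite /ball/= ltr_norml; apply/andP; split; lra.
  by lra.
have sumA : (f2 (d x) - eta) * s k ^+ 2 <=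
    \sum_i (2 * psi x - psi (x + s k *: e_ i) - psi (x - s k *: e_ i)).
  apply: le_trans (ler_sum _ (fun i _ => sec k i x nu _ Kx nu1 nuz Lf)).
  rewrite -mulr_sumr (eq_bigr (fun i => s k ^+ 2 * (nu ord0 i * nu ord0 i))); last first.
    by move=> i _; rewrite exprMn -expr2.
  by rewrite -mulr_sumr -/(dot nu nu) nu1 mulr1.
have -> : \sum_i s k ^- 2 * A k i x = G x ^+ 2 / (psi x * s k ^+ 2) *
    \sum_i (2 * psi x - psi (x + s k *: e_ i) - psi (x - s k *: e_ i)).
  rewrite mulr_sumr; apply: eq_bigr => i _; rewrite /A.
  by field; rewrite !gt_eqF ?psi_gt0.
apply: (@le_trans _ _ (G x ^+ 2 / (psi x * s k ^+ 2) * ((f2 (d x) - eta) * s k ^+ 2))).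
  rewrite VE psiE (_ : G x ^+ 2 / _ * _ = G x ^+ 2 * (f2 (d x) / f (d x))
     - eps * (G x ^+ 2 / (G x ^+ 2 + 1))); last first.
    by rewrite /eta; field; rewrite !gt_eqF.
  rewrite lerD2l lerN2 ger_pMr// ler_pdivrMr// mul1r lerDl.
  by [].
by rewrite ler_wpM2l// divr_ge0 ?sqr_ge0// mulr_ge0// sqr_ge0.
Qed.

End hardy_of_supersolution.

(** * Choice of the exponents *)

Section exponents.
Context {R : realType}.
Implicit Types m p lambda X a b : R.

(** When [X] is replaced by its bound [p - lambda], the left-hand side of the last
    inequality becomes [(m - 1) * (p - lambda ^ 2) + 2 * p * (p - lambda)]. The
    exponent [a = 1 / 2] maximizes [a - a ^ 2]; it also satisfies the last
    inequality unless [lambda] is far below [p], and then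
    [a = 3 / 4] leaves enough of [a - a ^ 2]. *)
Lemma exponents_lambda_ge0 m p lambda X : 1 <= m -> 1 / 2 <= p <= 1 ->
  0 <= lambda < p -> 0 <= X <= p - lambda ->
  let C := 4 * (p - lambda ^+ 2) in
  exists a b, [/\ 0 <= b, b <= a, p * (1 - p) <= C * (a - a ^+ 2) &
    (m + 2 * p - 1) * X + (m - 1) * (lambda - lambda ^+ 2)
      <= C * ((m - 1 + 2 * a) * b - b ^+ 2)].
Proof.
move=> m1 /andP[p1 p2] /andP[l0 lp] /andP[X0 X1] C.
have hX : (m + 2 * p - 1) * X <= (m + 2 * p - 1) * (p - lambda).
  by rewrite ler_wpM2l//; lra.
have l1 : lambda <= 1 by lra.
have hl : 0 <= lambda * (1 - lambda) by rewrite mulr_ge0//; lra.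
have hpl : 0 <= p * (p - lambda) by rewrite mulr_ge0//; lra.
have hm : 0 <= (m - 1) * (p - lambda ^+ 2) by rewrite mulr_ge0//; nra.
have [pl|pl] := leP ((p - lambda) ^+ 2) (p * (1 - p)).
  exists (1 / 2), (1 / 2); rewrite /C; split; [lra|lra|nra|].
  by apply: le_trans (lerD hX (lexx _)) _; nra.
exists (3 / 4), (3 / 4); rewrite /C; split; [lra|lra| |].
  have : 0 <= (p - lambda) * lambda by rewrite mulr_ge0//; lra.
  nra.
apply: le_trans (lerD hX (lexx _)) _.
have : p * (p - lambda) <= p - lambda by rewrite ler_piMl//; lra.
nra.
Qed.

(** The hypothesis on [X] says that
    [3 * p + X + X ^ 2 / (2 * m + 2 * p - 1) <= C]. With
    [alpha = p * (1 - p) / C <= 1 / 8], the exponent [a = 1 - 2 * alpha]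
    satisfies [alpha <= a - a ^ 2], and [b] maximizes
    [(m - 1 + 2 * a) * b - b ^ 2] among the [b <= a]; what is left is a
    quadratic inequality in [X]. *)
Lemma exponents_lambda_le0 m p l X : 0 < m -> 1 / 2 <= p <= 1 -> 0 <= l ->
  0 < X -> X + X ^+ 2 / (2 * m + 2 * p - 1) <= p + l ->
  let C := 4 * p + l in
  exists a b, [/\ 0 <= b, b <= a, p * (1 - p) <= C * (a - a ^+ 2) &
    (m + 2 * p - 1) * X <= C * ((m - 1 + 2 * a) * b - b ^+ 2)].
Proof.
move=> m0 /andP[p1 p2] l0 X0 HX C.
have C0 : 0 < C by rewrite /C; lra.
have p0 : 0 < p by lra.
pose alpha := p * (1 - p) / C.
have CalE : C * alpha = p * (1 - p) by rewrite /alpha; field; rewrite gt_eqF.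
have al0 : 0 <= alpha.
  by apply: divr_ge0; [apply: mulr_ge0; lra|exact: ltW].
have al1 : 4 * alpha <= 1 - p.
  rewrite /alpha mulrA ler_pdivrMr// /C.
  by have : 0 <= (1 - p) * l; [rewrite mulr_ge0//; lra|lra].
pose Y := X ^+ 2 / (2 * m + 2 * p - 1).
have W0 : 0 < 2 * m + 2 * p - 1 by lra.
have YE : Y * (2 * m + 2 * p - 1) = X ^+ 2 by rewrite /Y divfK// gt_eqF.
have Y0 : 0 <= Y by rewrite /Y divr_ge0 ?sqr_ge0// ltW.
have CX : 3 * p + X + Y <= C by rewrite /C; move: HX; rewrite -/Y; lra.
have Hal : p * (1 - p) <= C * ((1 - 2 * alpha) - (1 - 2 * alpha) ^+ 2).
  rewrite -CalE ler_pM2l//.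
  by have : 0 <= alpha * (1 - 4 * alpha); [rewrite mulr_ge0//; lra|nra].
have [m1|m1] := leP 1 m.
  exists (1 - 2 * alpha), (1 - 2 * alpha); split => //; first by lra.
  apply: (@le_trans _ _ (C * m - 2 * (m + 1) * (p * (1 - p)))); last first.
    rewrite -CalE.
    have : 0 <= C * (alpha * alpha).
      by apply: mulr_ge0; [exact: ltW|exact: mulr_ge0].
    nra.
  have h1 : (3 * p + X + Y) * m <= C * m by rewrite ler_pM2r.
  have h2 : X ^+ 2 <= 3 * (m * Y).
    by have : 0 <= Y * (m + 1 - 2 * p); [rewrite mulr_ge0//; lra|nra].
  (* the square completed in the quadratic inequality for [X] *)
  have h3 : 0 <= (X - 3 / 2 * (2 * p - 1)) ^+ 2 by exact: sqr_ge0.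
  have h4 : 0 <= (m - 1) * (p * (1 + 2 * p)).
    by apply: mulr_ge0; [lra|apply: mulr_ge0; lra].
  have h5 : 0 <= (p - 1 / 2) * (4 * p + 10).
    by rewrite mulr_ge0//; lra.
  nra.
exists (1 - 2 * alpha), ((m + 1 - 4 * alpha) / 2); split => //; [lra|lra|].
pose q := m + p.
have -> : (m - 1 + 2 * (1 - 2 * alpha)) * ((m + 1 - 4 * alpha) / 2) -
   ((m + 1 - 4 * alpha) / 2) ^+ 2 = (m + 1 - 4 * alpha) ^+ 2 / 4 by field.
have q0 : 0 < q by rewrite /q; lra.
have hq : q ^+ 2 <= (m + 1 - 4 * alpha) ^+ 2.
  by rewrite lerXn2r ?nnegrE /q//; lra.
apply: (@le_trans _ _ (C * (q ^+ 2 / 4))); last by rewrite ler_pM2l//; lra.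
have h1 : (3 * p + X + Y) * q ^+ 2 <= C * q ^+ 2.
  by rewrite ler_pM2r// exprn_gt0.
have h2 : X ^+ 2 <= Y * q ^+ 2.
  rewrite -YE ler_wpM2l// /q.
  by have := sqr_ge0 (m + p - 1); lra.
have qp : p <= q by rewrite /q; lra.
have ME : m + 2 * p - 1 = q + p - 1 by rewrite /q; lra.
rewrite ME.
have [p3|p3] := leP (3 / 4) p.
  have y3 : q - q ^+ 2 <= 4 * (1 - p).
    have [q1|q1] := leP 1 q; first by nra.
    by nra.
  have h3 : 0 <= (3 * q - (4 * p - 4 + 4 * q - q ^+ 2)) * X.
    by rewrite mulr_ge0//; lra.
  have h4 : 0 <= (X - 3 / 2 * q) ^+ 2 by exact: sqr_ge0.
  have h5 : 0 <= (p - 3 / 4) * q ^+ 2 by rewrite mulr_ge0 ?sqr_ge0//; lra.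
  nra.
have h3 : 0 <= (12 / 5 * q - (4 * p - 4 + 4 * q - q ^+ 2)) * X.
  by rewrite mulr_ge0//; have := sqr_ge0 (q - 4 / 5); lra.
have h4 : 0 <= (X - 6 / 5 * q) ^+ 2 by exact: sqr_ge0.
have h5 : 0 <= (p - 1 / 2) * q ^+ 2 by rewrite mulr_ge0 ?sqr_ge0//; lra.
have h6 : 0 <= q ^+ 2 by exact: sqr_ge0.
nra.
Qed.

End exponents.

(** * The two Hardy weights *)

Lemma real_scaled_limit (R : realFieldType) (a b c : R) : 0 <= b ->
  (forall u : R, 0 < u < 1 -> a + u * b <= c) -> a + b <= c.
Proof.
move=> b0 H; rewrite leNgt; apply/negP => cab.
have ac : a + 1 / 2 * b <= c by apply: H; apply/andP; split; lra.
have b1 : 0 < b.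
  by rewrite lt_neqAle b0 andbT; apply/eqP => bE; move: ac cab; rewrite -bE; lra.
have b2 : 0 < 2 * b by lra.
have r1 : (a + b - c) / (2 * b) <= 1 / 2 by rewrite ler_pdivrMr//; lra.
have r0 : 0 < (a + b - c) / (2 * b) by apply: divr_gt0 => //; lra.
have : a + (1 - (a + b - c) / (2 * b)) * b <= c.
  by apply: H; apply/andP; split; lra.
have -> : (1 - (a + b - c) / (2 * b)) * b = b - (a + b - c) / 2.
  by field; rewrite gt_eqF.
by lra.
Qed.

Lemma scaled_limit (R : realType) (X Y Z : \bar R) : (0 <= X)%E -> (0 <= Y)%E -> (Z < +oo)%E ->
  (forall u : R, 0 < u < 1 -> (X + u%:E * Y <= Z)%E) -> (X + Y <= Z)%E.
Proof.
move=> X0 Y0 Zoo H.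
have h2 : 0 < (1 / 2 : R) < 1 by apply/andP; split; lra.
have H2 := H _ h2.
have Z0 : (0 <= Z)%E by apply: le_trans H2; rewrite adde_ge0// mule_ge0// lee_fin; lra.
have Zf : Z \is a fin_num by rewrite ge0_fin_numE.
have Xf : X \is a fin_num.
  rewrite ge0_fin_numE//; apply: le_lt_trans Zoo; apply: le_trans H2.
  by rewrite leeDl// mule_ge0// lee_fin; lra.
have Yf : Y \is a fin_num.
  rewrite ge0_fin_numE// ltey; apply/eqP => YE.
  move: H2; rewrite YE gt0_muley ?lte_fin; last by lra.
  by rewrite addey -?ltNye ?(lt_le_trans _ X0)// leye_eq => /eqP ZE; rewrite ZE in Zoo.
rewrite -(fineK Xf) -(fineK Yf) -(fineK Zf) -EFinD lee_fin.
have {}H (u : R) : 0 < u < 1 -> fine X + u * fine Y <= fine Z.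
  by move=> /H; rewrite -{1}(fineK Xf) -{1}(fineK Yf) -{1}(fineK Zf) -EFinM -EFinD lee_fin.
exact: (real_scaled_limit (fine_ge0 Y0) H).
Qed.

Section hardy_distance.
Context {R : realType} {n : nat}.
Local Notation mu := (lebesgue_rV R n).
Variables (Omega : set 'rV[R]_n) (g : 'rV[R]_n -> R).
Hypothesis Omega_open : open Omega.
Hypothesis Omega_convex : convex_set Omega.
Hypothesis Omega_inradius : (inradius Omega < +oo)%E.
Hypothesis g_C1 : C1_compact_support Omega g.
Hypothesis grad_L2 : square_integrable Omega (fun x => enorm (gradient g x)).
Let delta x := fine (dist_boundary Omega x).
Let delta0 := fine (inradius Omega).

Lemma inradius_boundary_neq0 x : Omega x -> boundary Omega !=set0.
Proof.
move=> Ox; apply/set0P/negP => /eqP b0.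
have : (dist_boundary Omega x <= inradius Omega)%E by apply: ereal_sup_ubound; exists x.
rewrite /dist_boundary b0 image_set0 ereal_inf0 leye_eq => /eqP E.
by move: Omega_inradius; rewrite E.
Qed.

Lemma dist_boundary_le_inradius x : Omega x -> delta x <= delta0.
Proof.
move=> Ox; have b0 := inradius_boundary_neq0 Ox.
have [y [_ dE dE' _]] := dist_boundaryP x b0.
have xr : (dist_boundary Omega x <= inradius Omega)%E by apply: ereal_sup_ubound; exists x.
rewrite /delta dE -lee_fin -dE' (le_trans xr)// /delta0 fineK//.
by rewrite ge0_fin_numE// (le_trans _ xr)// dE' lee_fin enorm_ge0.
Qed.

(** The supersolution is [ssol a b beta m] with [beta = u / delta0 ^ m]. For
    [u < 1] it is still nondecreasing a little beyond the inradius, on an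
    interval [(0, D)] with [delta0 < D], so that no point of [Omega] is at the
    end of this interval; the result is the limit [u -> 1]. *)
Lemma hardy_distance (m a b A B C : R) : 0 < m -> 0 <= A -> 0 <= B -> 0 < C ->
  0 <= b -> b <= a -> A <= C * (a - a ^+ 2) ->
  B <= C * ((m - 1 + 2 * a) * b - b ^+ 2) ->
  (A%:E * (\int[mu]_(x in Omega) (`|g x| ^+ 2 / delta x ^+ 2)%:E) +
   (B / delta0 `^ m)%:E *
     (\int[mu]_(x in Omega) (`|g x| ^+ 2 / delta x `^ (2 - m))%:E)
   <= C%:E * (\int[mu]_(x in Omega) (enorm (gradient g x) ^+ 2)%:E))%E.
Proof.
move=> m0 A0 B0 C0 b0 ba Aa Bb.
have [->|/set0P[x0 Ox0]] := eqVneq Omega set0.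
  by rewrite !integral_set0 !mule0 adde0.
have bd0 := inradius_boundary_neq0 Ox0.
have dgt0 x : Omega x -> 0 < delta x.
  by move=> Ox; exact: dist_boundary_gt0.
have dle x : Omega x -> delta x <= delta0 by exact: dist_boundary_le_inradius.
have delta00 : 0 < delta0 by apply: lt_le_trans (dgt0 _ Ox0) (dle _ Ox0).
have bar x : Omega x -> exists2 nu, dot nu nu = 1 &
    forall z, Omega z -> delta z <= delta x + dot nu (z - x).
  by move=> Ox; exact: dist_boundary_barrier.
have mO : measurable Omega by exact: open_measurable_rV.
have md : measurable_fun Omega delta.
  by apply: open_continuous_measurable_rV => //; exact: barrier_continuous bar.
have mg : measurable_fun Omega g.
  apply: open_continuous_measurable_rV => // x /set_mem Ox.
  by apply: differentiable_continuous; case: g_C1 => + _ _ _; apply.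
have mg2 : measurable_fun Omega (fun x => `|g x| ^+ 2).
  by apply: measurable_funX; apply: measurableT_comp.
have mpow r : measurable_fun Omega (fun x => `|g x| ^+ 2 * delta x `^ r).
  apply: measurable_funM => //.
  exact: (measurableT_comp (measurable_powR r) md).
have mE1 : measurable_fun Omega (fun x => (`|g x| ^+ 2 / delta x ^+ 2)%:E).
  apply/measurable_EFinP.
  apply: (eq_measurable_fun (fun x => `|g x| ^+ 2 * delta x `^ (- 2%:R))) => //.
  by move=> x /set_mem Ox; rewrite powR_invn// ltW// dgt0.
have mE2 : measurable_fun Omega (fun x => (`|g x| ^+ 2 / delta x `^ (2 - m))%:E).
  apply/measurable_EFinP.
  apply: (eq_measurable_fun (fun x => `|g x| ^+ 2 * delta x `^ (- (2 - m)))) => //.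
  by move=> x _; rewrite powRN.
have E10 x : Omega x -> (0 <= (`|g x| ^+ 2 / delta x ^+ 2)%:E)%E.
  by move=> Ox; rewrite lee_fin divr_ge0// sqr_ge0.
have E20 x : Omega x -> (0 <= (`|g x| ^+ 2 / delta x `^ (2 - m))%:E)%E.
  by move=> Ox; rewrite lee_fin divr_ge0 ?sqr_ge0// powR_ge0.
have K0 : 0 <= B / delta0 `^ m by rewrite divr_ge0// powR_ge0.
apply: scaled_limit.
- by rewrite mule_ge0 ?lee_fin// integral_ge0.
- by rewrite mule_ge0 ?lee_fin// integral_ge0.
- by rewrite lte_mul_pinfty ?lee_fin ?(ltW C0)//; case: grad_L2.
move=> u /andP[u0 u1].
pose beta := u / delta0 `^ m.
have beta0 : 0 < beta by rewrite divr_gt0// powR_gt0.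
(* the solution of [beta * D ^ m = 1] *)
pose D := delta0 * u^-1 `^ m^-1.
have ui1 : 1 < u^-1 by rewrite invf_gt1.
have D1 : delta0 < D.
  have : 1 `^ m^-1 < u^-1 `^ m^-1.
    by rewrite gt0_ltr_powR ?invr_gt0// nnegrE// ltW// (lt_trans ltr01).
  by rewrite powR1 /D ltr_pMr.
have D0 : 0 < D by apply: lt_trans D1.
have bD (t : R) : 0 < t < D -> beta * t `^ m <= 1.
  move=> /andP[t0 tD].
  apply: (@le_trans _ _ (beta * D `^ m)).
    by rewrite ler_pM2l// ge0_ler_powR ?nnegrE ?ltW.
  rewrite /D powRM ?powR_ge0 ?(ltW delta00)// -powRrM mulVf ?gt_eqF//.
  rewrite powRr1; last by rewrite invr_ge0 ltW.
  have dm : 0 < delta0 `^ m by rewrite powR_gt0.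
  rewrite (_ : beta * _ = 1)// /beta; field.
  by rewrite !gt_eqF.
pose f := ssol a b beta m.
pose P := ssol_potential a b beta m.
have Plb (t : R) : 0 < t < D ->
    (A / C + B / C * (beta * t `^ m)) / t ^+ 2 <= P t.
  move=> tD; have /andP[t0 _] := tD; apply: ssol_potential_ge => //.
  - exact: ltW.
  - exact: bD.
  - by rewrite ler_pdivrMr// mulrC.
  - by rewrite ler_pdivrMr// mulrC.
have P0 (t : R) : 0 < t < D -> 0 <= P t.
  move=> tD; have /andP[t0 _] := tD; apply: le_trans (Plb t tD).
  apply: divr_ge0; last exact: sqr_ge0.
  apply: addr_ge0; first exact: divr_ge0 A0 (ltW C0).
  apply: mulr_ge0; first exact: divr_ge0 B0 (ltW C0).
  exact: mulr_ge0 (ltW beta0) (powR_ge0 _ _).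
have fP (t : R) : 0 < t < D -> 0 < f t by move=> /andP[t0 _]; exact: ssol_gt0.
have H : (\int[mu]_(x in Omega) (g x ^+ 2 * ((f (delta x) * P (delta x)) / f (delta x)))%:E <=
   \int[mu]_(x in Omega) (enorm (gradient g x) ^+ 2)%:E)%E.
  apply: (hardy_of_supersolution Omega_open g_C1 dgt0 dle D1 bar fP
    (f1 := ssol1 a b beta m) (f2 := fun t => f t * P t)) => t tD.
  - by apply: is_derive_ssol => //; case/andP: tD.
  - by apply: ssol1_ge0 (bD _ tD) => //; case/andP: tD.
  - by apply: is_derive_ssol1 => //; case/andP: tD.
  - by rewrite mulr_ge0 ?P0// ltW// fP.
  - by apply: continuous_ssol_potential => //; case/andP: tD.
pose W x := A * (`|g x| ^+ 2 / delta x ^+ 2) +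
  (B * beta) * (`|g x| ^+ 2 / delta x `^ (2 - m)).
have WP x : Omega x -> W x <= C * (g x ^+ 2 * (f (delta x) * P (delta x) / f (delta x))).
  move=> Ox; have dx0 := dgt0 _ Ox.
  have dD : 0 < delta x < D by rewrite dx0 (le_lt_trans (dle _ Ox)).
  have fx := fP _ dD.
  rewrite [f _ * _]mulrC mulfK ?gt_eqF// /W.
  have -> : delta x `^ (2 - m) = delta x ^+ 2 / delta x `^ m.
    rewrite (@powRB _ _ 2 m) ?(gt_eqF dx0) ?implybT//.
    by rewrite powR_mulrn// ltW.
  have dm : 0 < delta x `^ m by rewrite powR_gt0.
  rewrite real_normK ?num_real//.
  rewrite (_ : _ + _ = C * (g x ^+ 2 * ((A / C + B / C * (beta * delta x `^ m)) / delta x ^+ 2))).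
    by rewrite ler_pM2l// ler_wpM2l ?sqr_ge0// Plb.
  by field; rewrite !gt_eqF.
have -> : (A%:E * (\int[mu]_(x in Omega) (`|g x| ^+ 2 / delta x ^+ 2)%:E) +
   u%:E * ((B / delta0 `^ m)%:E *
     (\int[mu]_(x in Omega) (`|g x| ^+ 2 / delta x `^ (2 - m))%:E)) =
   \int[mu]_(x in Omega) (W x)%:E)%E.
  rewrite muleA -EFinM (_ : u * _ = B * beta); last by rewrite /beta; ring.
  have Bb0 : 0 <= B * beta by rewrite mulr_ge0// ltW.
  rewrite -(ge0_integralZl_EFin mu mO E10 mE1 A0).
  rewrite -(ge0_integralZl_EFin mu mO E20 mE2 Bb0).
  rewrite -ge0_integralD//; last 4 first.
  - by move=> x Ox; rewrite mule_ge0// E10.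
  - exact: measurable_funeM.
  - by move=> x Ox; rewrite mule_ge0// E20.
  - exact: measurable_funeM.
have mfP : measurable_fun Omega
    (fun x => (g x ^+ 2 * (f (delta x) * P (delta x) / f (delta x)))%:E).
  apply/measurable_EFinP; apply: measurable_funM; first exact: measurable_funX.
  apply: (eq_measurable_fun (fun x => f (delta x) * P (delta x) / f (delta x))) => //.
  apply: open_continuous_measurable_rV => // x xO; have /set_mem Ox := xO.
  have cd := barrier_continuous Omega_open bar xO.
  have dx0 := dgt0 _ Ox.
  have ck : {for delta x, continuous (fun t => f t * P t / f t)}.
    apply: cvgM; first exact: (@continuous_ssol_potential _ a b beta _ m0 _ dx0).
    apply: cvgV; first by rewrite gt_eqF// ssol_gt0.
    exact: (is_derive1_continuous (is_derive_ssol a b beta m0 dx0)).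
  exact: (@continuous_comp _ _ _ delta (fun t => f t * P t / f t) x cd ck).
apply: (@le_trans _ _ (\int[mu]_(x in Omega)
    (C%:E * (g x ^+ 2 * (f (delta x) * P (delta x) / f (delta x)))%:E))%E).
  apply: ge0_le_integral => //.
  - move=> x Ox; rewrite lee_fin addr_ge0// mulr_ge0//.
    + by rewrite -lee_fin E10.
    + by rewrite mulr_ge0// ltW.
    + by rewrite -lee_fin E20.
  - apply/measurable_EFinP; apply: measurable_funD; apply: measurable_funM => //;
      exact/measurable_EFinP.
  - exact: measurable_funeM.
rewrite ge0_integralZl_EFin ?(ltW C0)//.
  by rewrite lee_wpmul2l// lee_fin ltW.
move=> x Ox; have dD : 0 < delta x < D by rewrite dgt0// (le_lt_trans (dle _ Ox)).
rewrite lee_fin mulr_ge0 ?sqr_ge0// divr_ge0 ?(ltW (fP _ dD))//.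
by rewrite mulr_ge0 ?P0// ltW// fP.
Qed.

End hardy_distance.

Theorem theorem7 (R : realType) (n : nat) (Omega : set 'rV[R]_n)
    (g : 'rV[R]_n -> R)
    (Omega_open : open Omega) (Omega_convex : convex_set Omega)
    (Omega_inradius : (inradius Omega < +oo)%E)
    (g_C1 : C1_compact_support Omega g)
    (grad_L2 : square_integrable Omega (fun x => enorm (gradient g x))) :
  let mu := lebesgue_rV R n in
  let delta := fun x => fine (dist_boundary Omega x) in
  let delta0 := fine (inradius Omega) in
  (forall m nu lambda c : R,
     1 < m -> 0 <= nu <= 1 / m -> 0 <= lambda < (1 + nu * m) / 2 ->
     bessel_root nu m lambda c ->
     (((1 - nu ^+ 2 * m ^+ 2) / 4)%:E *
        (\int[mu]_(x in Omega) (`|g x| ^+ 2 / delta x ^+ 2)%:E) +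
      ((c ^+ 2 + (m - 1) * (lambda - lambda ^+ 2)) / delta0 `^ m)%:E *
        (\int[mu]_(x in Omega) (`|g x| ^+ 2 / delta x `^ (2 - m))%:E)
      <= (4 * ((1 + nu * m) / 2 - lambda ^+ 2))%:E *
        (\int[mu]_(x in Omega) (enorm (gradient g x) ^+ 2)%:E))%E) /\
  (forall m nu lambda c : R,
     0 < m -> 0 <= nu < 1 / m -> lambda <= 0 ->
     bessel_root nu m lambda c ->
     (((1 - nu ^+ 2 * m ^+ 2) / 4)%:E *
        (\int[mu]_(x in Omega) (`|g x| ^+ 2 / delta x ^+ 2)%:E) +
      (c ^+ 2 / delta0 `^ m)%:E *
        (\int[mu]_(x in Omega) (`|g x| ^+ 2 / delta x `^ (2 - m))%:E)
      <= (2 * (1 + nu * m) + `|lambda|)%:E *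
        (\int[mu]_(x in Omega) (enorm (gradient g x) ^+ 2)%:E))%E).
Proof.
move=> mu delta delta0; split=> m nu lambda c m1 /andP[nu0 nu1] lam root.
  have m0 : 0 < m by apply: lt_trans m1.
  have num : nu * m <= 1 by rewrite -ler_pdivlMr.
  have num0 : 0 <= nu * m by rewrite mulr_ge0// ltW.
  have [X0 XX] := bessel_root_bound m0 nu0 root.
  set p := (1 + nu * m) / 2 in lam XX *.
  set X := c ^+ 2 / _ in X0 XX.
  have p12 : 1 / 2 <= p <= 1 by rewrite /p; apply/andP; split; lra.
  have X1 : 0 <= X <= p - lambda.
    rewrite ltW//=; apply: le_trans XX; rewrite lerDl divr_ge0 ?sqr_ge0//.
    by rewrite mulr_ge0 ?addr_ge0// ltW.
  have cE : c ^+ 2 = (m + 2 * p - 1) * X.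
    rewrite (_ : m + 2 * p - 1 = m * (1 + nu)); last by rewrite /p; field.
    by rewrite /X mulrC divfK// mulf_neq0 ?gt_eqF// ltr_pwDl.
  have [a [b [b0 ba Aa Bb]]] := exponents_lambda_ge0 (ltW m1) p12 lam X1.
  have AE : (1 - nu ^+ 2 * m ^+ 2) / 4 = p * (1 - p) by rewrite /p; field.
  case/andP: lam => l0 lp; case/andP: p12 => p1 p2.
  have lamp : lambda ^+ 2 < p.
    by apply: le_lt_trans lp; rewrite expr2 ler_piMl//; lra.
  rewrite cE AE; apply: (hardy_distance Omega_open Omega_convex Omega_inradius
    g_C1 grad_L2 m0 _ _ _ b0 ba Aa Bb).
  - by rewrite mulr_ge0//; lra.
  - apply: addr_ge0; first by rewrite mulr_ge0 ?(ltW X0)//; lra.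
    by apply: mulr_ge0; [lra|rewrite subr_ge0 expr2 ler_piMl//; lra].
  - by rewrite mulr_gt0// subr_gt0.
have num : nu * m <= 1 by rewrite -ler_pdivlMr// ltW.
have num0 : 0 <= nu * m by rewrite mulr_ge0// ltW.
have [X0 XX] := bessel_root_bound m1 nu0 root.
set p := (1 + nu * m) / 2 in XX *.
set X := c ^+ 2 / _ in X0 XX.
have p12 : 1 / 2 <= p <= 1 by rewrite /p; apply/andP; split; lra.
have cE : c ^+ 2 = (m + 2 * p - 1) * X.
  rewrite (_ : m + 2 * p - 1 = m * (1 + nu)); last by rewrite /p; field.
  by rewrite /X mulrC divfK// mulf_neq0 ?gt_eqF// ltr_pwDl.
have l0 : 0 <= - lambda by rewrite oppr_ge0.
have XX' : X + X ^+ 2 / (2 * m + 2 * p - 1) <= p + - lambda.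
  by rewrite (_ : 2 * m + 2 * p - 1 = m * (nu + 2))// /p; field.
have [a [b [b0 ba Aa Bb]]] := exponents_lambda_le0 m1 p12 l0 X0 XX'.
have AE : (1 - nu ^+ 2 * m ^+ 2) / 4 = p * (1 - p) by rewrite /p; field.
case/andP: p12 => p1 p2.
have -> : 2 * (1 + nu * m) + `|lambda| = 4 * p + - lambda.
  by rewrite ler0_norm// /p; field.
rewrite cE AE; apply: (hardy_distance Omega_open Omega_convex Omega_inradius
  g_C1 grad_L2 m1 _ _ _ b0 ba Aa Bb).
- by rewrite mulr_ge0//; lra.
- by rewrite mulr_ge0 ?(ltW X0)//; lra.
- by lra.
Qed.
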